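(* Let $\tau$ be a random ergodic pseudometric on $\mathbb{R}^d$. If there is an $\varepsilon>0$ such that $$\mathbb{E}\left[\max\{\tau(0,x) \mid \|x\|_\infty\le 1\}^{d+\varepsilon}\right]<\infty,$$ then there is a (deterministic) semi-norm $\mu=\mu_\tau$ on $\mathbb{R}^d$ such that, almost surely, $$\lim_{\|x\|_2\to\infty}\frac{1}{\|x\|_2}\bigl(\tau(0,x)-\mu(x)\bigr)=0,$$ where the limit is over $x\in\mathbb{R}^d$.
   Context: All random objects live on a probability space $(\Omega,\mathfrak{F},\mathbb{P})$. A random pseudometric on $\mathbb{R}^d$ is a family $\tau=\{\tau(x,y)\mid x,y\in\mathbb{R}^d\}$ of $[0,\infty)$-valued random variables such that a.s. $\tau(x,x)=0$, $\tau(x,y)=\tau(y,x)$ and $\tau(x,y)\le\tau(x,z)+\tau(z,y)$ for all $x,y,z\in\mathbb{R}^d$. It is a random element of $[0,\infty)^{\mathbb{R}^d\times\mathbb{R}^d}$ with the $\sigma$-algebra induced by the finite dimensional projections. The shift $\theta_z$, $z\in\mathbb{R}^d$, acts on this space by $(\theta_z\tau)(x,y)=\tau(x-z,y-z)$. $\tau$ is stationary if $\theta_z\tau\overset{d}{=}\tau$ for all $z\in\mathbb{R}^d$. For $x\in\mathbb{R}^d$ let $\mathcal{I}_x$ be the $\sigma$-algebra of measurable sets $A\subset[0,\infty)^{\mathbb{R}^d\times\mathbb{R}^d}$ with $\theta_xA=A$. $\tau$ is called ergodic if it is stationary and $\mathbb{P}[\tau\in A]\in\{0,1\}$ for all $x\in\mathbb{R}^d\setminus\{0\}$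 and all $A\in\mathcal{I}_x$. A semi-norm is a map $\mu:\mathbb{R}^d\to[0,\infty)$ with $\mu(\lambda x)=|\lambda|\mu(x)$ and $\mu(x+y)\le\mu(x)+\mu(y)$ for all $\lambda\in\mathbb{R}$, $x,y\in\mathbb{R}^d$.
   Formalization: Added hypothesis: for every z, max{(θ_z τ)(0,x) : ‖x‖_∞≤1} (as a supremum) is a random variable with the same law as for z=0; stationarity of finite-dimensional laws does not imply this, and without it the claim is false (Euclidean distance plus spikes on U+Z^d). *)

(* Defs.v *)
From mathcomp Require Import all_boot all_order all_algebra.
From mathcomp Require Import all_classical all_reals all_analysis.
From mathcomp Require Import measurable_realfun.
Set Implicit Arguments.
Unset Strict Implicit.
Unset Printing Implicit Defensive.
Import Order.TTheory GRing.Theory Num.Theory.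
Import numFieldNormedType.Exports.
Local Open Scope classical_set_scope.
Local Open Scope ring_scope.

(* The space [0, +oo)^(R^d x R^d). *)
Definition path_space (R : realType) (d : nat) : Type :=
  'rV[R]_d -> 'rV[R]_d -> {nonneg R}.

Definition cylinders (R : realType) (d : nat) : set (set (path_space R d)) :=
  [set A | exists x y (B : set R),
     measurable B /\ A = [set p | B (p x y)%:num]].

Definition path_measurable (R : realType) (d : nat) (A : set (path_space R d)) :
  Prop := <<s cylinders (R := R) (d := d) >> A.

Definition theta (R : realType) (d : nat) (z : 'rV[R]_d) (p : path_space R d) :
  path_space R d := fun x y => p (x - z) (y - z).

Definition is_pseudometric (R : realType) (d : nat) (p : path_space R d) : Prop :=
  [/\ forall x, (p x x)%:num = 0,
      forall x y, (p x y)%:num = (p y x)%:num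
    & forall x y z, (p x y)%:num <= (p x z)%:num + (p z y)%:num].

Section random_pseudometrics.
Context {R : realType} {disp : measure_display} {T : measurableType disp}.
Context {d : nat}.
Implicit Types (P : probability T R) (tau : T -> path_space R d).

Definition random_pseudometric P tau : Prop :=
  (forall x y, measurable_fun setT (fun w => (tau w x y)%:num)) /\
  {ae P, forall w, is_pseudometric (tau w)}.

Definition stationary P tau : Prop :=
  forall z (A : set (path_space R d)), path_measurable A ->
    P [set w | A (theta z (tau w))] = P [set w | A (tau w)].

Definition ergodic P tau : Prop :=
  stationary P tau /\
  forall x (A : set (path_space R d)), x != 0 ->
    path_measurable A -> theta x @` A = A ->
    P [set w | A (tau w)] = 0%E \/ P [set w | A (tau w)] = 1%E.

End random_pseudometrics.

(* The norm of 'rV[R]_d provided by the library is the sup norm. The maximum is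
   taken as a supremum in [0, +oo], so that it always exists. *)
Definition unit_max (R : realType) (d : nat) (p : path_space R d) : \bar R :=
  ereal_sup [set (p 0 x)%:num%:E | x in [set x | `|x| <= 1]].

(* [unit_max] depends on uncountably many coordinates, hence it is not
   measurable for the cylinder sigma-algebra, and [theta z tau] having the same
   law as [tau] says nothing about the law of [unit_max (theta z tau)]. The
   definition below requires [unit_max] to be a legitimate observable of the
   stationary field [tau]: [unit_max (theta z tau)] is a random variable with
   the same law as [unit_max tau].

   Without it the moment condition only constrains [tau] near the origin. Let
   U be uniform in [0, 1]^d and let f vanish outside U + Z^d and on the unit
   box, and be equal to expR `|x| at the other points x of U + Z^d. Then
   tau(x, y) := norm2 (x - y) + f x + f y for x <> y, and tau(x, x) := 0, is a
   pseudometric with the same finite-dimensional laws as the Euclidean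
   distance. It is therefore ergodic, [unit_max tau] is almost surely equal to
   a constant, but tau(0, x) / norm2 x is almost surely unbounded as
   norm2 x tends to infinity. *)
Definition stationary_unit_max (R : realType) (disp : measure_display)
    (T : measurableType disp) (d : nat) (P : probability T R)
    (tau : T -> path_space R d) : Prop :=
  forall z,
    measurable_fun setT (fun w => unit_max (theta z (tau w))) /\
    forall B : set (\bar R), measurable B ->
      P [set w | B (unit_max (theta z (tau w)))] =
      P [set w | B (unit_max (tau w))].

Definition seminorm (R : realType) (d : nat) (mu : 'rV[R]_d -> R) : Prop :=
  [/\ forall x, 0 <= mu x,
      forall (a : R) x, mu (a *: x) = `|a| * mu x
    & forall x y, mu (x + y) <= mu x + mu y].

Definition norm2 (R : realType) (d : nat) (x : 'rV[R]_d) : R :=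
  Num.sqrt (\sum_(i < d) x 0 i ^+ 2).

Definition norm2_pinfty (R : realType) (d : nat) : set_system 'rV[R]_d :=
  filter_from setT (fun M : R => [set x | M < norm2 x]).

(* Main.v *)
From HB Require Import structures.
Require Import Defs.
From mathcomp Require Import all_boot all_order all_algebra.
From mathcomp Require Import all_classical all_reals all_analysis.
From mathcomp Require Import measurable_realfun.
From mathcomp Require Import ring lra zify.
Import Order.TTheory GRing.Theory Num.Theory.
Import numFieldNormedType.Exports.
Set Implicit Arguments.
Unset Strict Implicit.
Unset Printing Implicit Defensive.
Local Open Scope classical_set_scope.
Local Open Scope ring_scope.

(** The functions x |-> tau(0, N x) / N converge locally uniformly as N tends
    to infinity, because they converge along every lattice direction and are
    almost surely equicontinuous in the limit.

    Along a direction v, tau(0, n v) / n tends to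
    mu(v) = inf_n E tau(0, n v) / n by the subadditive ergodic theorem. All of
    the ergodic theory rests on one tiling argument ([subadditive_tiling],
    [subadditive_mean_le]): if almost every orbit of a subadditive process X
    has a place n where X n is at most a n, then cutting long orbit segments
    greedily at such places shows that the mean of X n is at most
    a n + o(n). For X n = tau(0, n v) this gives the lower bound
    ([subadditive_liminf_ge]); for minus a Birkhoff sum it gives the upper
    bound ([birkhoff_average_le]) and the maximal inequality
    ([maximal_inequality]). As a limit of the subadditive means E tau(0, n v) / n,
    mu is a seminorm ([asympD], [asympZ]).

    Equicontinuity is a discrete Morrey inequality. Let h(z) be the sum of the
    lengths tau(z, z + u_i) of the lattice steps at z. When a cube of side 2^k
    around a lattice point x is doubled, the average of tau(x, .) over the cube
    increases by at most a constant times 2^k times the average of h over the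
    new cube ([box_sum_double], [cube_average_dist]). If the averages of h^p'
    over the cubes [0, 2^M)^d are bounded and p' > d, then the averages of h
    over subcubes of side 2^k are at most a constant times 2^((M - k) d / p').
    The increments up to scale 2^(M - L) therefore form a geometric series of
    sum at most C r^L 2^M with r < 1 ([morrey_dist_le]): lattice points of
    [0, 2^M)^d in a common dyadic cube of side 2^(M - L) have distance small
    compared with 2^M, as soon as L is large. The averages of h^p' are bounded
    because they are dominated by a maximal function of h^p', taken along one
    coordinate after the other ([ae_bounded_orbit_averages]). Each coordinate costs some
    integrability, so p' is chosen strictly between d and d + eps.

    Between the lattice points tau is controlled by unit_max: by Markov's
    inequality and a union bound over the 2^(M d) lattice points of [0, 2^M)^d,
    unit_max is at most b^M at all of them, for some b < 2 and all large M
    ([ae_unit_max_growth]).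

    The space is cut into 2^d octants, in each of which lattice points are
    combinations of signed unit vectors with natural coefficients;
    [octant_shape] adds up the errors there. *)

(** * Sums over lattice boxes and a discrete Morrey inequality *)

Section LatticeSums.
Context {R : realFieldType} {V : zmodType} {I : eqType}.
Variable u : I -> V.
Implicit Types (s : seq I) (n : nat) (F G : V -> R) (x y z : V) (w : I -> nat).

Definition line_sum (e : V) n G z : R := \sum_(j < n) G (z + e *+ j).

Fixpoint box_sum n s G : V -> R :=
  if s is i :: s' then line_sum (u i) n (box_sum n s' G) else G.

Definition lattice_pt s w : V := \sum_(i <- s) u i *+ w i.

Lemma lattice_pt_cons i s w :
  lattice_pt (i :: s) w = u i *+ w i + lattice_pt s w.
Proof. by rewrite /lattice_pt big_cons. Qed.

Lemma lattice_ptD s v w :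
  lattice_pt s (fun i => (v i + w i)%N) = lattice_pt s v + lattice_pt s w.
Proof. by rewrite /lattice_pt -big_split; apply: eq_bigr => i _; rewrite mulrnDr. Qed.

Lemma lattice_ptM s n w :
  lattice_pt s (fun i => (n * w i)%N) = lattice_pt s w *+ n.
Proof.
by rewrite /lattice_pt -sumrMnl; apply: eq_bigr => i _; rewrite mulnC mulrnA.
Qed.

Lemma box_sum_ext n s F G z : F =1 G -> box_sum n s F z = box_sum n s G z.
Proof.
move=> FG; elim: s z => [|i s IH] z //=.
by apply: eq_bigr => j _.
Qed.

Lemma box_sum_shift n s G a z :
  box_sum n s G (z + a) = box_sum n s (fun y => G (y + a)) z.
Proof.
elim: s z => [|i s IH] z //=.
by apply: eq_bigr => j _; rewrite addrAC IH.
Qed.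

Lemma box_sum_le n s F G z : (forall y, F y <= G y) ->
  box_sum n s F z <= box_sum n s G z.
Proof.
move=> FG; elim: s z => [|i s IH] z //=.
by apply: ler_sum => j _.
Qed.

Lemma box_sum_ge0 n s G z : (forall y, 0 <= G y) -> 0 <= box_sum n s G z.
Proof.
move=> G0; elim: s z => [|i s IH] z //=.
by apply: sumr_ge0 => j _.
Qed.

Lemma box_sumD n s F G z :
  box_sum n s (fun y => F y + G y) z = box_sum n s F z + box_sum n s G z.
Proof.
elim: s z => [|i s IH] z //=.
by rewrite /line_sum -big_split; apply: eq_bigr => j _ /=.
Qed.

Lemma box_sumZ n s c G z :
  box_sum n s (fun y => c * G y) z = c * box_sum n s G z.
Proof.
elim: s z => [|i s IH] z //=.
by rewrite /line_sum mulr_sumr; apply: eq_bigr => j _ /=.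
Qed.

Lemma box_sum_sum n s k (F : nat -> V -> R) z :
  box_sum n s (fun y => \sum_(j < k) F j y) z = \sum_(j < k) box_sum n s (F j) z.
Proof.
elim: s z => [|i s IH] z //=.
by rewrite /line_sum exchange_big; apply: eq_bigr => j _ /=.
Qed.

Lemma box_sum_cst n s c z : box_sum n s (fun=> c) z = n%:R ^+ size s * c.
Proof.
elim: s z => [|i s IH] z /=; first by rewrite expr0 mul1r.
rewrite /line_sum (eq_bigr (fun=> n%:R ^+ size s * c)) //.
by rewrite sumr_const card_ord exprS -mulrA mulr_natl.
Qed.

Lemma line_sum_sub e n N a G z : (forall y, 0 <= G y) -> (a + n <= N)%N ->
  line_sum e n G (z + e *+ a) <= line_sum e N G z.
Proof.
move=> G0 anN; rewrite /line_sum.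
rewrite -(big_mkord xpredT (fun j => G (z + e *+ j))) /=.
rewrite (@big_cat_nat _ _ _ (a + n)%N) //= (@big_cat_nat _ _ _ a) ?leq_addr //=.
have -> : \sum_(a <= i < (a + n)%N) G (z + e *+ i) =
    \sum_(j < n) G (z + e *+ a + e *+ j).
  rewrite -[X in \sum_(X <= _ < _) _]add0n big_addn addKn big_mkord.
  by apply: eq_bigr => j _; rewrite -addrA -mulrnDr addnC.
have p1 : 0 <= \sum_(0 <= i < a) G (z + e *+ i) by apply: sumr_ge0.
have p2 : 0 <= \sum_((a + n)%N <= i < N) G (z + e *+ i) by apply: sumr_ge0.
lra.
Qed.

Lemma line_sum_le e n F G z : (forall y, F y <= G y) ->
  line_sum e n F z <= line_sum e n G z.
Proof. by move=> FG; apply: ler_sum. Qed.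

Lemma box_sum_sub n N s a G z : (forall y, 0 <= G y) ->
  (forall i, i \in s -> (a i + n <= N)%N) ->
  box_sum n s G (z + lattice_pt s a) <= box_sum N s G z.
Proof.
move=> G0; elim: s z => [|i s IH] z aN /=.
  by rewrite /lattice_pt big_nil addr0.
have aNs j : j \in s -> (a j + n <= N)%N by move=> js; apply: aN; rewrite inE js orbT.
rewrite lattice_pt_cons.
apply: (@le_trans _ _ (line_sum (u i) n (box_sum N s G) (z + u i *+ a i))).
  rewrite /line_sum; apply: ler_sum => j _.
  have -> : z + (u i *+ a i + lattice_pt s a) + u i *+ j =
      z + u i *+ a i + u i *+ j + lattice_pt s a.
    by rewrite -!addrA [lattice_pt _ _ + _]addrC.
  exact: IH.
apply: line_sum_sub; first by move=> y; exact: box_sum_ge0.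
by apply: aN; rewrite mem_head.
Qed.

(** The sums of [F] over the two halves of the segment are compared term by
    term, at the cost of [n] sums of [H] over the whole segment; [b] tells which
    half is kept. *)
Lemma line_sum_double e n (b : bool) F H z :
  (forall y, 0 <= H y) ->
  (forall y, `|F (y + e *+ n) - F y| <= \sum_(j < n) H (y + e *+ j)) ->
  line_sum e n.*2 F z <=
    2 * line_sum e n F (z + e *+ (b * n)) + n%:R * line_sum e n.*2 H z.
Proof.
move=> H0 FH.
have -> : line_sum e n.*2 F z = line_sum e n F z + line_sum e n F (z + e *+ n).
  rewrite /line_sum -addnn big_split_ord /=; congr (_ + _).
  by apply: eq_bigr => j _; rewrite mulrnDr addrA.
have D : `|line_sum e n F (z + e *+ n) - line_sum e n F z| <=
    n%:R * line_sum e n.*2 H z.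
  rewrite /line_sum -sumrB.
  apply: le_trans (ler_norm_sum _ _ _) _.
  have -> : n%:R * line_sum e n.*2 H z = \sum_(i < n) line_sum e n.*2 H z.
    by rewrite sumr_const card_ord mulr_natl.
  apply: ler_sum => i _; rewrite addrAC.
  apply: le_trans (FH _) _.
  apply: line_sum_sub => //.
  by rewrite -addnn leq_add2r ltnW.
case: b; rewrite ?mul1n ?mul0n ?mulr0n ?addr0.
  by move: D; rewrite ler_norml => /andP[]; lra.
by move: D; rewrite ler_norml => /andP[]; lra.
Qed.

(** One step of Morrey's argument: [h] bounds the increments of [F] along
    lattice steps, and [b] tells in which corner of the doubled box the old box
    lies. The coordinates are doubled one at a time: the sum of [F] over a box
    in the coordinates of [s] has its increments along a further coordinate
    bounded by the sum of [h] over the same box, so [line_sum_double] applies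
    to these sums. *)
Lemma box_sum_double n s (b : I -> bool) F h z :
  (forall y, 0 <= h y) ->
  (forall i y, `|F (y + u i *+ n) - F y| <= \sum_(j < n) h (y + u i *+ j)) ->
  box_sum n.*2 s F z <= 2 ^+ size s *
    (box_sum n s F (z + lattice_pt s (fun i => (b i * n)%N)) +
     n%:R * box_sum n.*2 s h z).
Proof.
move=> h0 Fh; elim: s z => [|i s IH] z /=.
  rewrite expr0 mul1r /lattice_pt big_nil addr0 lerDl.
  by rewrite mulr_ge0.
set a := lattice_pt s (fun i => (b i * n)%N) in IH *.
pose F' y := box_sum n s F (y + a); pose H y := box_sum n s h (y + a).
have H0 y : 0 <= H y by exact: box_sum_ge0.
have F'H y : `|F' (y + u i *+ n) - F' y| <= \sum_(j < n) H (y + u i *+ j).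
  rewrite /F' /H.
  under eq_bigr do rewrite (addrAC y) box_sum_shift.
  rewrite -(box_sum_sum n s n (fun j z => h (z + u i *+ j))).
  rewrite (addrAC y) (box_sum_shift _ _ _ (u i *+ n)).
  set a' := y + a.
  have /= E := box_sumD n s (fun z => F (z + u i *+ n)) (fun z => -1 * F z) a'.
  rewrite box_sumZ mulN1r in E.
  rewrite -E ler_norml; apply/andP; split.
    rewrite -[leLHS]mulN1r -box_sumZ; apply: box_sum_le => z'.
    by have := Fh i z'; rewrite ler_norml => /andP[]; lra.
  apply: box_sum_le => z'.
  by have := Fh i z'; rewrite ler_norml => /andP[]; lra.
have HH y : H y <= box_sum n.*2 s h y.
  apply: box_sum_sub => // j _.
  by rewrite -addnn leq_add2r; case: (b j); rewrite ?mul1n ?mul0n.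
apply: (@le_trans _ _ (2 ^+ size s *
    (line_sum (u i) n.*2 F' z + n%:R * line_sum (u i) n.*2 (box_sum n.*2 s h) z))).
  rewrite /line_sum mulr_sumr -big_split mulr_sumr.
  by apply: ler_sum => j _ /=; exact: IH.
rewrite exprS [2 * _]mulrC -[leRHS]mulrA ler_wpM2l //.
have := line_sum_double (b i) z H0 F'H.
have : line_sum (u i) n.*2 H z <= line_sum (u i) n.*2 (box_sum n.*2 s h) z.
  exact: line_sum_le.
rewrite -(ler_pM2l (_ : 0 < 1)) ?mul1r // => h1.
rewrite lattice_pt_cons.
have -> : line_sum (u i) n (box_sum n s F) (z + (u i *+ (b i * n) + a)) =
   line_sum (u i) n F' (z + u i *+ (b i * n)).
  by apply: eq_bigr => j _; rewrite /F' -!addrA [a + _]addrC.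
move=> h2.
have : n%:R * line_sum (u i) n.*2 H z <=
  n%:R * line_sum (u i) n.*2 (box_sum n.*2 s h) z by rewrite ler_wpM2l.
lra.
Qed.

Lemma box_sum1 s G z : box_sum 1 s G z = G z.
Proof.
elim: s z => [|i s IH] z //=.
by rewrite /line_sum big_ord1 mulr0n addr0.
Qed.

Variable dist : V -> V -> R.
Hypothesis dist_refl : forall x, dist x x = 0.
Hypothesis dist_sym : forall x y, dist x y = dist y x.
Hypothesis dist_tri : forall x y z, dist x y <= dist x z + dist z y.
Variable h : V -> R.
Hypothesis h_ge0 : forall x, 0 <= h x.
Hypothesis h_step : forall i x, dist x (x + u i) <= h x.

Lemma dist_line_le i n y :
  dist y (y + u i *+ n) <= \sum_(j < n) h (y + u i *+ j).
Proof.
elim: n => [|n IH]; first by rewrite mulr0n addr0 dist_refl big_ord0.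
rewrite big_ord_recr /=; apply: le_trans (dist_tri _ _ (y + u i *+ n)) _.
by rewrite lerD // mulrSr addrA.
Qed.

Variables (s : seq I) (M : nat) (H A : nat -> R).
Hypothesis box_h_le : forall k c, (k <= M)%N ->
  (forall i, c i + 2 ^ k <= 2 ^ M)%N ->
  box_sum (2 ^ k) s h (lattice_pt s c) <= (2 ^ k)%:R ^+ size s * H k.
Hypothesis A0 : 0 <= A 0.
Hypothesis AS : forall m, (m < M)%N ->
  A m + 2 ^+ size s * ((2 ^ m)%:R * H m.+1) <= A m.+1.

(** The cubes of the induction form the chain of dyadic cubes, relative to the
    corner [c], that contain the point with coordinates [c + w]. The leading
    binary digits [b] of [w] locate each cube in the next one, and [A] adds up
    the costs of the doublings. *)
Lemma cube_average_dist m c w : (m <= M)%N ->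
  (forall i, c i + 2 ^ m <= 2 ^ M)%N -> (forall i, w i < 2 ^ m)%N ->
  box_sum (2 ^ m) s (dist (lattice_pt s (fun i => (c i + w i)%N)))
    (lattice_pt s c) <= (2 ^ m)%:R ^+ size s * A m.
Proof.
elim: m c w => [|m IH] c w mM cM wm.
  rewrite expn0 box_sum1 expr1n mul1r.
  suff -> : lattice_pt s (fun i => (c i + w i)%N) = lattice_pt s c by rewrite dist_refl.
  by apply: eq_bigr => i _; have := wm i; rewrite expn0 ltnS leqn0 => /eqP->; rewrite addn0.
pose b i := (2 ^ m <= w i)%N.
pose c' i := (c i + b i * 2 ^ m)%N.
pose w' i := (w i - b i * 2 ^ m)%N.
set x := lattice_pt s _.
have Ex : x = lattice_pt s (fun i => (c' i + w' i)%N).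
  apply: eq_bigr => i _; congr (_ *+ _); rewrite /c' /w' /b.
  by case: leqP => h1; rewrite ?mul1n ?mul0n ?subn0 ?addn0 // -addnA subnKC.
have c'M i : (c' i + 2 ^ m <= 2 ^ M)%N.
  rewrite /c'; apply: leq_trans (cM i); rewrite expnS mul2n -addnn -addnA leq_add2l leq_add2r.
  by case: (b i); rewrite ?mul1n ?mul0n.
have w'm i : (w' i < 2 ^ m)%N.
  rewrite /w' /b; have := wm i; rewrite expnS mul2n -addnn.
  case: leqP => h1; rewrite ?mul1n ?mul0n ?subn0 //.
  by lia.
have := IH c' w' (ltnW mM) c'M w'm; rewrite -Ex => IHm.
rewrite expnS mul2n.
have D i y : `|dist x (y + u i *+ 2 ^ m) - dist x y| <=
    \sum_(j < 2 ^ m) h (y + u i *+ j).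
  apply: le_trans (dist_line_le i (2 ^ m) y).
  rewrite ler_norml; apply/andP; split.
    have := dist_tri x y (y + u i *+ 2 ^ m).
    by rewrite (dist_sym (y + _) y); lra.
  by have := dist_tri x (y + u i *+ 2 ^ m) y; lra.
apply: le_trans (box_sum_double s b _ h_ge0 D) _.
rewrite -lattice_ptD -/c'.
have := box_h_le mM cM; rewrite expnS mul2n => bh.
have := AS mM.
set p := 2 ^+ size s; set q := (2 ^ m)%:R; set hh := box_sum _ _ h _ in bh *.
have p0 : 0 <= p by rewrite exprn_ge0.
have q0 : 0 <= q :> R by [].
have Eq : (2 ^ m).*2%:R ^+ size s = p * q ^+ size s :> R.
  by rewrite -mul2n natrM exprMn.
rewrite Eq in bh *.
move=> AA; rewrite -mulrA ler_wpM2l //.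
have qs0 : 0 <= q ^+ size s by rewrite exprn_ge0.
have : q ^+ size s * (A m + p * (q * H m.+1)) <= q ^+ size s * A m.+1.
  by rewrite ler_wpM2l.
have : q * hh <= q * (p * q ^+ size s * H m.+1) by rewrite ler_wpM2l.
by lra.
Qed.

(** Both points are compared with the average point of the common cube. *)
Lemma cube_dist_le m c w : (m <= M)%N ->
  (forall i, c i + 2 ^ m <= 2 ^ M)%N -> (forall i, w i < 2 ^ m)%N ->
  dist (lattice_pt s c) (lattice_pt s (fun i => (c i + w i)%N)) <= 2 * A m.
Proof.
move=> mM cM wm.
have h1 := cube_average_dist mM cM wm.
have := @cube_average_dist m c (fun=> 0%N) mM cM (fun i => ltac:(by rewrite expn_gt0)).
have -> : lattice_pt s (fun i => (c i + 0)%N) = lattice_pt s c.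
  by apply: eq_bigr => i _; rewrite addn0.
set x := lattice_pt s c in h1 *; set y := lattice_pt s _ in h1 *.
move=> h2.
have q0 : 0 < (2 ^ m)%:R ^+ size s :> R by rewrite exprn_gt0 // ltr0n expn_gt0.
rewrite -(ler_pM2l q0) -(box_sum_cst _ s (dist x y) x).
apply: (@le_trans _ _ (box_sum (2 ^ m) s (fun a => dist x a + dist y a) x)).
  by apply: box_sum_le => a; rewrite (dist_sym y).
by rewrite box_sumD; lra.
Qed.

End LatticeSums.

(** * Greedy tiling of orbits *)

Section Tiling.
Context {R : realFieldType} {Y : Type} (T : Y -> Y).

(** Greedy tiling of the orbit segment [0, n): outside [B] jump over a block of
    length [k] on which [X k] is at most [a * k]; advance by one step in [B], or
    when this block would stick out of the segment. The single steps lie in [B]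
    or among the last [L] places of the segment, and each of them costs at
    most [w] more than [a]. *)
Lemma subadditive_tiling (X : nat -> Y -> R) (a : R) (L : nat) (w : Y -> R) (B : set Y) :
  (forall y, X 0 y <= 0) ->
  (forall m n y, X (m + n)%N y <= X m y + X n (iter m T y)) ->
  (forall y, 0 <= w y) -> (forall y, X 1%N y <= a + w y) ->
  (forall y, ~ B y -> exists2 k, (0 < k <= L)%N & X k y <= a * k%:R) ->
  forall n y, X n y <= a * n%:R +
    \sum_(j < n) (\1_B (iter j T y) + (n <= j + L)%N%:R) * w (iter j T y).
Proof.
move=> X0 subX w0 X1 goodB.
pose g n j y : R := (\1_B (iter j T y) + (n <= j + L)%N%:R) * w (iter j T y).
have g0 n j y : 0 <= g n j y by rewrite /g mulr_ge0 // addr_ge0 // indicE.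
have gS n k y : (k <= n)%N -> \sum_(j < n) g n j y =
    \sum_(0 <= j < k) g n j y + \sum_(j < n - k) g (n - k)%N j (iter k T y).
  move=> kn; rewrite -(big_mkord xpredT (fun j => g n j y)) (big_cat_nat (leq0n k) kn) //=.
  congr (_ + _); rewrite -[X in \sum_(X <= _ < _) _]add0n big_addn big_mkord.
  apply: eq_bigr => j _; rewrite /g iterD.
  by rewrite -addnA [(k + L)%N]addnC addnA leq_subLR [(k + _)%N]addnC.
have jump n k y : (0 < k <= n)%N -> X k y <= a * k%:R + \sum_(0 <= j < k) g n j y ->
    (X (n - k)%N (iter k T y) <= a * (n - k)%:R +
       \sum_(j < n - k) g (n - k)%N j (iter k T y)) ->
    X n y <= a * n%:R + \sum_(j < n) g n j y.
  move=> /andP[k0 kn] Xk Xnk; rewrite (gS n k) //.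
  have := subX k (n - k)%N y; rewrite subnKC // => Xn.
  by move: Xnk; rewrite natrB // => Xnk; lra.
move=> n; have [m] := ubnP n; elim: m n => // m IH n nm y.
case: n nm => [|n] nm; first by rewrite big_ord0 mulr0 addr0.
have step : 1 <= \1_B y + (n.+1 <= 0 + L)%N%:R :> R ->
    X n.+1 y <= a * n.+1%:R + \sum_(j < n.+1) g n.+1 j y.
  move=> h; apply: (jump _ 1%N) => //.
    rewrite mulr1 big_nat1 /g /=; apply: le_trans (X1 y) _.
    by rewrite lerD2l ler_peMl.
  by rewrite subSS subn0; apply: IH.
have [By|nBy] := pselect (B y).
  by apply: step; rewrite indicE mem_set // lerDl.
have [k /andP[k0 kL] Xk] := goodB y nBy.
have [kn|nk] := leqP k n.+1.
  apply: (jump _ k); rewrite ?k0 //.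
    by apply: (le_trans Xk); rewrite lerDl; apply: sumr_ge0.
  apply: IH; lia.
by apply: step; rewrite (leq_trans (ltnW nk)) // lerDr indicE.
Qed.

End Tiling.

Section MeasurePreserving.
Context {d : measure_display} {Y : measurableType d} {R : realType}.
Variables (Q : probability Y R) (T : Y -> Y).
Hypothesis mT : measurable_fun setT T.
Hypothesis QT : forall A, measurable A -> Q (T @^-1` A) = Q A.

Lemma measurable_iter n : measurable_fun setT (iter n T).
Proof.
elim: n => [|n IH]; first exact: measurable_id.
by apply: (measurableT_comp mT IH).
Qed.

Lemma measure_iter n A : measurable A -> Q (iter n T @^-1` A) = Q A.
Proof.
elim: n A => [|n IH] A mA //.
have mTA : measurable (T @^-1` A) by rewrite -[X in measurable X]setTI; exact: mT.
by rewrite -(QT mA) -(IH _ mTA).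
Qed.

Lemma ge0_integral_iter n (f : Y -> \bar R) : measurable_fun setT f ->
  (forall y, 0 <= f y)%E -> (\int[Q]_y f (iter n T y) = \int[Q]_y f y)%E.
Proof.
move=> mf f0; have mi := measurable_iter n.
transitivity (\int[pushforward Q (iter n T)]_y f y)%E.
  by rewrite (ge0_integral_pushforward mi).
by apply: eq_measure_integral => A mA _ /=; exact: measure_iter.
Qed.

Lemma integrable_iter n (f : Y -> R) :
  Q.-integrable setT (EFin \o f) -> Q.-integrable setT (EFin \o (f \o iter n T)).
Proof.
move=> /integrableP[mf foo]; apply/integrableP; split.
  exact: (measurableT_comp mf (measurable_iter n)).
rewrite (ge0_integral_iter n (f := fun y => `|(f y)%:E|%E)) //.
exact: measurableT_comp.
Qed.

Lemma Rintegral_iter n (f : Y -> R) : Q.-integrable setT (EFin \o f) ->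
  \int[Q]_y f (iter n T y) = \int[Q]_y f y.
Proof.
move=> fi; have fni := integrable_iter n fi; have mi := measurable_iter n.
have mf := measurable_int _ fi.
congr fine; transitivity (\int[pushforward Q (iter n T)]_y (f y)%:E)%E.
  by rewrite (integral_pushforward mi).
by apply: eq_measure_integral => A mA _ /=; exact: measure_iter.
Qed.

Lemma integrable_EFin_sum n (f : nat -> Y -> R) :
  (forall j, Q.-integrable setT (EFin \o f j)) ->
  Q.-integrable setT (EFin \o (fun y => \sum_(j < n) f j y)).
Proof.
move=> fi; have := @integrable_sum _ _ _ Q setT measurableT 'I_n (index_enum 'I_n)
  xpredT (fun j => EFin \o f j) (fun j _ => fi j).
by apply: eq_integrable => // y _ /=; rewrite sumEFin.
Qed.

Lemma Rintegral_sum n (f : nat -> Y -> R) :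
  (forall j, Q.-integrable setT (EFin \o f j)) ->
  \int[Q]_y (\sum_(j < n) f j y) = \sum_(j < n) \int[Q]_y f j y.
Proof.
move=> fi; elim: n => [|n IH].
  by rewrite big_ord0; under eq_Rintegral do rewrite big_ord0; rewrite Rintegral_cst // mul0r.
rewrite big_ord_recr /= -IH -RintegralD //; last exact: integrable_EFin_sum.
by apply: eq_Rintegral => y _; rewrite big_ord_recr.
Qed.

(** Minus the Birkhoff sums of [f] form the subadditive process to which the
    tiling argument is applied below. *)
Lemma integrable_opp_birkhoff_sum n (f : Y -> R) : Q.-integrable setT (EFin \o f) ->
  Q.-integrable setT (EFin \o (fun y => - \sum_(j < n) f (iter j T y))).
Proof.
move=> fi; have Si := @integrable_EFin_sum n (fun j => f \o iter j T)
  (fun j => integrable_iter j fi).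
by apply: (eq_integrable measurableT _ _ _ (integrableN Si)).
Qed.

Lemma Rintegral_opp_birkhoff_sum n (f : Y -> R) : Q.-integrable setT (EFin \o f) ->
  \int[Q]_y (- \sum_(j < n) f (iter j T y)) = - (\int[Q]_y f y) * n%:R.
Proof.
move=> fi; have fji j : Q.-integrable setT (EFin \o (f \o iter j T)).
  exact: integrable_iter.
transitivity (\int[Q]_y (-1 * \sum_(j < n) (f \o iter j T) y)).
  by apply: eq_Rintegral => y _; rewrite mulN1r.
rewrite RintegralZl //; last exact: (@integrable_EFin_sum n (fun j => f \o iter j T)).
rewrite (Rintegral_sum n fji) (eq_bigr (fun=> \int[Q]_y f y)); last first.
  by move=> j _; exact: Rintegral_iter.
by rewrite sumr_const card_ord mulN1r mulNr mulr_natr.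
Qed.

Lemma sum_tail_count n L : (\sum_(j < n) (n <= j + L) <= L)%N.
Proof.
suff -> : (\sum_(j < n) (n <= j + L) = minn n L)%N by exact: geq_minr.
elim: n => [|n IH]; first by rewrite big_ord0 min0n.
rewrite big_ord_recl /= add0n.
under eq_bigr do rewrite /bump /= add1n addSn ltnS.
rewrite IH; lia.
Qed.

(** The tiling inequality is integrated and divided by [n]: the contribution of
    the last [L] places vanishes as [n] grows. *)
Lemma subadditive_mean_le (X : nat -> Y -> R) (a g : R) (L : nat) (w : Y -> R)
    (B : set Y) :
  (forall y, X 0 y <= 0) ->
  (forall m n y, X (m + n)%N y <= X m y + X n (iter m T y)) ->
  (forall n, Q.-integrable setT (EFin \o X n)) ->
  (forall n, g * n%:R <= \int[Q]_y X n y) ->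
  (forall y, 0 <= w y) -> Q.-integrable setT (EFin \o w) ->
  (forall y, X 1%N y <= a + w y) -> measurable B ->
  (forall y, ~ B y -> exists2 k, (0 < k <= L)%N & X k y <= a * k%:R) ->
  g <= a + \int[Q]_y (\1_B y * w y).
Proof.
move=> X0 subX Xi gX w0 wi X1 mB goodB.
set e1 := Rintegral _ _ _; pose e2 := \int[Q]_y w y.
have e20 : 0 <= e2 by apply: Rintegral_ge0.
have Bwi : Q.-integrable setT (EFin \o (fun y => \1_B y * w y)).
  apply: (le_integrable measurableT _ _ wi) => //.
    apply/measurable_EFinP; apply: measurable_funM; first exact: measurable_indic.
    by apply/measurable_EFinP; exact: measurable_int wi.
  move=> y _ /=; rewrite lee_fin normrM ger0_norm ?indicE //.
  by rewrite ler_piMl //; case: (_ \in _).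
have main n : g * n%:R <= a * n%:R + (n%:R * e1 + L%:R * e2).
  pose f (j : nat) y := \1_B (iter j T y) * w (iter j T y) + (n <= j + L)%N%:R * w (iter j T y).
  have i1 j : Q.-integrable setT (EFin \o (fun y => \1_B (iter j T y) * w (iter j T y))).
    exact: (integrable_iter j Bwi).
  have i2 j : Q.-integrable setT (EFin \o (fun y => (n <= j + L)%N%:R * w (iter j T y))).
    apply: eq_integrable (integrableZl measurableT (n <= j + L)%N%:R (integrable_iter j wi)) => //.
  have fi j : Q.-integrable setT (EFin \o f j).
    by apply: eq_integrable (integrableD measurableT (i1 j) (i2 j)).
  apply: le_trans (gX n) _.
  have ci : Q.-integrable setT (EFin \o (fun _ : Y => a * n%:R)).
    exact: finite_measure_integrable_cst.
  apply: (@le_trans _ _ (\int[Q]_y (a * n%:R + \sum_(j < n) f j y))).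
    apply: le_Rintegral => //.
      by apply: eq_integrable (integrableD measurableT ci (integrable_EFin_sum n fi)).
    move=> y _; have := subadditive_tiling X0 subX w0 X1 goodB n y.
    by under eq_bigr do rewrite mulrDl.
  rewrite RintegralD //; last exact: integrable_EFin_sum.
  have Q1 : fine (Q setT) = 1 by rewrite probability_setT.
  rewrite Rintegral_cst // Q1 /= mulr1 lerD2l Rintegral_sum //.
  have -> : \sum_(j < n) \int[Q]_y f j y = \sum_(j < n) (e1 + (n <= j + L)%N%:R * e2).
    apply: eq_bigr => j _; rewrite RintegralD //; congr (_ + _).
      by rewrite (Rintegral_iter j Bwi).
    rewrite RintegralZl //; last exact: integrable_iter.
    by rewrite (Rintegral_iter j wi).
  rewrite big_split /= sumr_const card_ord -[_ *+ n]mulr_natl lerD2l.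
  by rewrite -mulr_suml -natr_sum ler_wpM2r // ler_nat sum_tail_count.
rewrite leNgt; apply/negP => lt_ag.
have D0 : 0 < g - (a + e1) by lra.
have [n Hn] : exists n : nat, L%:R * e2 / (g - (a + e1)) < n%:R.
  exists (Num.truncn (L%:R * e2 / (g - (a + e1)))).+1.
  exact: truncnS_gt.
move: Hn; rewrite ltr_pdivrMr // => Hn; have := main n; nra.
Qed.

End MeasurePreserving.

(** * The subadditive ergodic theorem *)

Section Kingman.
Context {d : measure_display} {Y : measurableType d} {R : realType}.
Variables (Q : probability Y R) (T : Y -> Y).
Hypothesis mT : measurable_fun setT T.
Hypothesis QT : forall A, measurable A -> Q (T @^-1` A) = Q A.
Hypothesis ergQ : forall A, measurable A -> T @^-1` A = A -> Q A = 0%E \/ Q A = 1%E.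

(** The preimages of [E] under the iterates of [T] decrease and have the same
    measure, so their intersection, which is exactly invariant, has the measure
    of [E]. *)
Lemma ergodic_preimage_sub (E : set Y) : measurable E -> T @^-1` E `<=` E ->
  Q E = 0%E \/ Q E = 1%E.
Proof.
move=> mE TE.
pose F n := iter n T @^-1` E.
have mF n : measurable (F n).
  by rewrite -[X in measurable X]setTI; exact: (measurable_iter mT).
have FS n : F n.+1 `<=` F n.
  by move=> y; rewrite /F /preimage /= => /TE.
have mFi : measurable (\bigcap_n F n) by apply: bigcap_measurable.
have Fi : T @^-1` (\bigcap_n F n) = \bigcap_n F n.
  apply/seteqP; split => y Hy n _.
    by apply: FS; rewrite /F /preimage /= -iterS iterSr; exact: (Hy n).
  by have := Hy n.+1 I; rewrite /F /preimage /= -iterS iterSr.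
have <- : Q (\bigcap_n F n) = Q E.
  have nF : nonincreasing_seq F.
    apply/nonincreasing_seqP => n; apply/subsetPset; exact: FS.
  have := nonincreasing_cvg_mu (mu := Q) _ mF mFi nF.
  have Q0 : (Q (F 0%N) < +oo)%E by rewrite (le_lt_trans (probability_le1 _ _)) ?ltry.
  move=> /(_ Q0).
  have -> : Q \o F = cst (Q E) by apply/funext => n /=; exact: (measure_iter mT QT).
  by move=> h; apply: (cvg_unique _ h (cvg_cst _)).
exact: ergQ.
Qed.

(** The lower half of Kingman's theorem. Fix [a'] between [a] and [g]. To be
    infinitely often below [(a' - k.+1%:R^-1) * n%:R], for some [k], is a
    property that passes from [T y] to [y] by subadditivity. If it held almost
    surely, [subadditive_mean_le] would apply to [a'] with exceptional sets that
    decrease to a null set, and would give [g <= a']. *)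
Lemma subadditive_liminf_ge (X : nat -> Y -> R) (a g : R) :
  (forall y, X 0 y <= 0) ->
  (forall m n y, X (m + n)%N y <= X m y + X n (iter m T y)) ->
  (forall n, Q.-integrable setT (EFin \o X n)) ->
  (forall n, g * n%:R <= \int[Q]_y X n y) -> a < g ->
  {ae Q, forall y, \forall n \near \oo, a * n%:R <= X n y}.
Proof.
move=> X0 subX Xi gX ag.
have mX n : measurable_fun setT (X n) by apply/measurable_EFinP; exact: measurable_int (Xi n).
pose a' := (a + g) / 2.
have aa' : a < a' by rewrite /a'; lra.
have a'g : a' < g by rewrite /a'; lra.
have mlow b n : measurable [set y | X n y < b].
  rewrite -[X in measurable X]setTI.
  have -> : [set y | X n y < b] = X n @^-1` `]-oo, b[%classic.
    by apply/seteqP; split => y /=; rewrite in_itv.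
  exact: mX.
pose E := \bigcup_k \bigcap_m \bigcup_(n >= m) [set y | X n y < (a' - k.+1%:R^-1) * n%:R].
have mE : measurable E.
  apply: bigcup_measurable => k _; apply: bigcap_measurable => // m _.
  by apply: bigcup_measurable => n _; exact: mlow.
have E_spec y : (forall m, exists2 n, (m <= n)%N & X n y < a * n%:R) -> E y.
  move=> H; have [k Hk] : exists k, k.+1%:R^-1 < a' - a.
    exists (Num.truncn (a' - a)^-1).
    have := truncnS_gt (a' - a)^-1 => h.
    by rewrite invf_plt ?posrE ?subr_gt0 ?ltr0n.
  exists k => // m _; have [n mn Xn] := H m; exists n => //=.
  apply: lt_le_trans Xn _; rewrite ler_wpM2r //; by move: Hk; move: (k.+1%:R^-1) => p; lra.
have TE : T @^-1` E `<=` E.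
  move=> y [k _ Hk]; exists k.+1 => // m _.
  (* The passage from [T y] to [y] costs [X 1 y]; for large [n] it is paid by
     the gap between the slopes of index [k] and [k.+1]. *)
  pose dl : R := k.+1%:R^-1 - k.+2%:R^-1.
  have dl0 : 0 < dl by rewrite subr_gt0 ltf_pV2 ?posrE ?ltr0n // ltr_nat.
  pose c := X 1%N y - (a' - k.+2%:R^-1).
  pose m' := (maxn m (Num.truncn (c / dl)).+1).
  have [n m'n /= Xn] := Hk m' I.
  have := m'n; rewrite /= geq_max => /andP[mn cn].
  exists n.+1; first by rewrite /= (leq_trans mn).
  rewrite /=; have := subX 1%N n y; rewrite add1n => h.
  have c_lt : c < n%:R * dl.
    rewrite -ltr_pdivrMr //; apply: lt_le_trans (truncnS_gt _) _.
    by rewrite ler_nat.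
  apply: le_lt_trans h _.
  rewrite -(natr1 n); move: c_lt; rewrite /c /dl /=.
  move: Xn => /=. set x := X n _. move: (k.+1%:R^-1) (k.+2%:R^-1) (n%:R) => p q nn.
  by lra.
have low y : E y -> exists2 n, (0 < n)%N & X n y <= a' * n%:R.
  move=> [k _ Hk]; have [n /= n0 Xn] := Hk 1%N I; exists n => //.
  apply: le_trans (ltW Xn) _; rewrite ler_wpM2r //.
  by rewrite lerBlDr lerDl invr_ge0.
have [QE|QE] := ergodic_preimage_sub mE TE.
  exists E; split => // y /= Hy; apply: E_spec => m.
  apply: contrapT => Hn; apply: Hy; exists m => // n mn /=.
  by rewrite leNgt; apply/negP => Xn; apply: Hn; exists n.
exfalso.
pose B L := ~` \bigcup_(k in [set k | (0 < k <= L)%N]) [set y | X k y <= a' * k%:R].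
have mB L : measurable (B L).
  apply: measurableC; apply: bigcup_measurable => k _.
  rewrite -[X in measurable X]setTI.
  have -> : [set y | X k y <= a' * k%:R] = X k @^-1` `]-oo, (a' * k%:R)].
    by apply/seteqP; split => y /=; rewrite in_itv.
  exact: mX.
pose w y := `|X 1%N y - a'|.
have ai : Q.-integrable setT (EFin \o (fun _ : Y => a')) by exact: finite_measure_integrable_cst.
have wi : Q.-integrable setT (EFin \o w).
  apply: (@integrable_norm _ _ _ _ _ (fun y => X 1%N y - a')).
  by apply: eq_integrable (integrableB measurableT (Xi 1%N) ai).
have key L : g <= a' + \int[Q]_y (\1_(B L) y * w y).
  apply: (@subadditive_mean_le _ _ _ Q T mT QT X a' g L w (B L)) => //.
  - by rewrite /w.
  - by move=> y; have := ler_norm (X 1%N y - a'); rewrite /w; lra.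
  - move=> y /contrapT [k /= kL Xk]; by exists k.
have mw : measurable_fun setT w by apply/measurable_EFinP; exact: measurable_int wi.
pose f L y : \bar R := (\1_(B L) y * w y)%:E.
have mf L : measurable_fun setT (f L).
  by apply/measurable_EFinP; apply: measurable_funM => //; apply: measurable_indic.
have m0 : measurable_fun [set: Y] (cst 0%E : Y -> \bar R) by exact: measurable_cst.
have f_cvg : {ae Q, forall y, setT y -> f ^~ y @ \oo --> (cst 0%E y : \bar R)}.
  exists (~` E); split; first exact: measurableC.
    by rewrite probability_setC // QE subee.
  move=> y /=; apply: contra_not => Ey _; have [n n0 Xn] := low y Ey.
  apply: cvg_near_cst; near=> L; rewrite /f indicE memNset ?mul0r //.
  rewrite /B /=; apply; exists n => //=; rewrite n0 /=.
  by near: L; exists n.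
have f_dom : {ae Q, forall y L, setT y -> (`|f L y| <= (EFin \o w) y)%E}.
  apply: aeW => y L _ /=; rewrite lee_fin normrM !ger0_norm ?/w ?indicE //.
  by rewrite ler_piMl //; case: (_ \in _).
have [_ _] := dominated_convergence measurableT mf m0 f_cvg wi f_dom.
rewrite integral0 => /fine_cvgP[_] /cvgrPdist_lt /(_ (g - a')).
rewrite subr_gt0 => /(_ a'g) [L _ /(_ L (leqnn L)) /=].
rewrite sub0r normrN => h.
have := key L; have := ler_norm (fine (\int[Q]_y (\1_(B L) y * w y)%:E)%E).
by rewrite /Rintegral; move: h; set z := fine _; lra.
Unshelve. all: by end_near.
Qed.

(** The upper half of Birkhoff's theorem: the process is minus the Birkhoff
    sums. *)
Lemma birkhoff_average_le (f : Y -> R) (b : R) :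
  Q.-integrable setT (EFin \o f) -> \int[Q]_y f y < b ->
  {ae Q, forall y, \forall n \near \oo, \sum_(j < n) f (iter j T y) <= b * n%:R}.
Proof.
move=> fi fb; pose X n y := - \sum_(j < n) f (iter j T y).
have : {ae Q, forall y, \forall n \near \oo, - b * n%:R <= X n y}.
  apply: (@subadditive_liminf_ge X (- b) (- \int[Q]_y f y)).
  - by move=> y; rewrite /X big_ord0 oppr0.
  - move=> m n y; rewrite /X -opprD lerN2 big_split_ord /= lerD2l.
    by apply: ler_sum => j _; rewrite -iterD addnC.
  - by move=> n; exact: (integrable_opp_birkhoff_sum mT QT n fi).
  - by move=> n; rewrite (Rintegral_opp_birkhoff_sum mT QT n fi).
  - by rewrite ltrN2.
apply: filterS => y; apply: filterS => n.
by rewrite /X mulNr lerN2.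
Qed.

End Kingman.

(** * Tails and moments *)

(** A substitute for Jensen's inequality: the right-hand side is affine in
    [t `^ q], hence can be averaged, and the threshold [m] is optimized
    afterwards. *)
Lemma le_add_powR {R : realType} (q m t : R) : 1 <= q -> 0 < m -> 0 <= t ->
  t <= m + t `^ q * (m / m `^ q).
Proof.
move=> q1 m0 t0; have mq : 0 < m `^ q by exact: powR_gt0.
have [tm|mt] := leP t m.
  by rewrite (le_trans tm) // lerDl mulr_ge0 ?powR_ge0 // divr_ge0 ?powR_ge0 // ltW.
have s1 : 1 <= t / m by rewrite ler_pdivlMr // mul1r ltW.
have Et : t = m * (t / m) by rewrite mulrCA divff ?mulr1 // gt_eqF.
have Eq : t `^ q = m `^ q * (t / m) `^ q.
  by rewrite {1}Et powRM ?divr_ge0 // ltW.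
have -> : t `^ q * (m / m `^ q) = m * (t / m) `^ q.
  by rewrite Eq [m `^ q * _]mulrC mulrACA divff ?gt_eqF // mulr1 mulrC.
have := le1r_powR s1 q1; rewrite -(ler_pM2l m0) -Et => h.
by rewrite (le_trans h) // lerDr ltW.
Qed.

Section Tails.
Context {d : measure_display} {Y : measurableType d} {R : realType}.
Variable (Q : probability Y R).

Lemma measurable_gt (f : Y -> R) c : measurable_fun setT f ->
  measurable [set y | c < f y].
Proof.
move=> mf; rewrite -[X in measurable X]setTI.
have -> : [set y | c < f y] = f @^-1` `]c, +oo[%classic.
  by apply/seteqP; split => y /=; rewrite in_itv /= andbT.
exact: mf.
Qed.

Lemma probability_fineK A : measurable A -> (fine (Q A))%:E = Q A.
Proof.
move=> mA; rewrite fineK // ge0_fin_numE //.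
by rewrite (le_lt_trans (probability_le1 _ _)) ?ltry.
Qed.

Lemma integral_cst_probability (c : R) : (\int[Q]_y c%:E)%E = c%:E.
Proof.
rewrite integral_cst // [X in (_ * X)%E](_ : _ = 1%E) ?mule1 //.
exact: probability_setT.
Qed.

Lemma integral_indic_fine A : measurable A ->
  (\int[Q]_y (\1_A y)%:E)%E = (fine (Q A))%:E.
Proof.
move=> mA; rewrite integral_indic // setIT; exact/esym/probability_fineK.
Qed.

Lemma measurable_egt (g : Y -> \bar R) c : measurable_fun setT g ->
  measurable [set y | (c < g y)%E].
Proof.
move=> mg; rewrite -[X in measurable X]setTI.
have -> : [set y | (c < g y)%E] = g @^-1` `]c, +oo%E]%classic.
  by apply/seteqP; split => y /=; rewrite in_itv /= leey andbT.
by apply: mg => //; exact: emeasurable_itv.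
Qed.

Lemma markov_egt (g : Y -> \bar R) (c D : R) : 0 < c -> measurable_fun setT g ->
  (forall y, 0 <= g y)%E -> (\int[Q]_y g y <= D%:E)%E ->
  (Q [set y | (c%:E < g y)%E] <= (D / c)%:E)%E.
Proof.
move=> c0 mg g0 gD; have mA := measurable_egt c%:E mg.
set A := [set y | _] in mA *.
have : (\int[Q]_y (c%:E * (\1_A y)%:E) <= \int[Q]_y g y)%E.
  apply: ge0_le_integral => //.
  - by move=> y _; rewrite -EFinM lee_fin mulr_ge0 ?indicE // ltW.
  - apply/measurable_EFinP; apply: measurable_funM => //; exact: measurable_indic.
  - move=> y _; rewrite indicE; case: (boolP (y \in A)).
      by rewrite inE mule1 => /ltW.
    by rewrite mule0.
rewrite ge0_integralZl_EFin ?(ltW c0) //; last first.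
  by apply/measurable_EFinP; exact: measurable_indic.
rewrite integral_indic_fine // -EFinM => h.
have {}h := le_trans h gD; rewrite lee_fin in h.
by rewrite -(probability_fineK mA) lee_fin ler_pdivlMr // mulrC.
Qed.

Lemma markov_gt (g : Y -> R) (c D : R) : 0 < c -> measurable_fun setT g ->
  (forall y, 0 <= g y) -> (\int[Q]_y (g y)%:E <= D%:E)%E ->
  (Q [set y | (c < g y)%R] <= (D / c)%:E)%E.
Proof.
move=> c0 mg g0 gD.
by apply: (@markov_egt (EFin \o g)) => //; exact/measurable_EFinP.
Qed.

(** If [t] lies between two consecutive levels [2 * 2 ^+ k] then the term of
    the last level below [t] already dominates [t `^ q]. *)
Lemma powR_le_layers (q t : R) K : 0 <= q -> 0 <= t -> t <= 2 * 2 ^+ K ->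
  t `^ q <= 2 `^ q + \sum_(k < K) 4 `^ q * (2 ^+ k) `^ q * (2 * 2 ^+ k < t)%R%:R.
Proof.
move=> q0 t0; elim: K => [|K IH] tK.
  rewrite expr0 mulr1 in tK.
  by rewrite big_ord0 addr0; apply: ge0_ler_powR; rewrite ?nnegrE.
have s0 n : 0 <= \sum_(k < n) 4 `^ q * (2 ^+ k) `^ q * (2 * 2 ^+ k < t)%R%:R.
  by apply: sumr_ge0 => k _; rewrite !mulr_ge0 ?powR_ge0.
rewrite big_ord_recr /=; have [tK'|Kt] := leP t (2 * 2 ^+ K).
  by rewrite mulr0 addr0; exact: IH.
rewrite mulr1 -powRM ?exprn_ge0 //.
have : t `^ q <= (4 * 2 ^+ K) `^ q.
  apply: ge0_ler_powR => //; rewrite ?nnegrE ?mulr_ge0 ?exprn_ge0 //.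
  by move: tK; rewrite exprS; lra.
have := s0 K; have := powR_ge0 2 q; lra.
Qed.

(** Weak L^q is contained in L^q' for q' < q: the tail bounds at the dyadic
    levels sum to a geometric series of ratio 2^(q' - q). *)
Lemma moment_of_tails (q q' D : R) : 0 <= q' -> q' < q -> 0 <= D ->
  exists D', forall g : Y -> R, measurable_fun setT g -> (forall y, 0 <= g y) ->
    (forall c, 0 < c -> (Q [set y | (2 * c < g y)%R] <= (D / c `^ q)%:E)%E) ->
    (\int[Q]_y (g y `^ q')%:E <= D'%:E)%E.
Proof.
move=> q'0 qq' D0.
pose r := 2 `^ (q' - q); pose C := 4 `^ q' * D.
have r0 : 0 < r by exact: powR_gt0.
have r1 : r < 1.
  have -> : 1 = 2 `^ 0 :> R by rewrite powRr0.
  by rewrite /r /powR pnatr_eq0 /= ltr_expR ltr_pM2r ?ln_gt0 ?ltr1n // subr_lt0.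
have C0 : 0 <= C by rewrite mulr_ge0 ?powR_ge0.
exists (2 `^ q' + C / (1 - r)) => g mg g0 tail.
pose A k := [set y | 2 * 2 ^+ k < g y].
have mA k : measurable (A k) by exact: measurable_gt.
pose c k := 4 `^ q' * (2 ^+ k) `^ q'.
have c0 k : 0 <= c k by rewrite mulr_ge0 ?powR_ge0.
pose f k y : \bar R := (c k * \1_(A k) y)%:E.
have f0 k y : (0 <= f k y)%E by rewrite lee_fin mulr_ge0 ?indicE.
have mf k : measurable_fun setT (f k).
  by apply/measurable_EFinP; apply: measurable_funM => //; apply: measurable_indic.
have ms : measurable_fun setT (fun y => \sum_(0 <= k <oo) f k y)%E.
  exact: ge0_emeasurable_sum.
have le1 : (\int[Q]_y (g y `^ q')%:E <=
    \int[Q]_y ((2 `^ q')%:E + \sum_(0 <= k <oo) f k y))%E.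
  apply: ge0_le_integral => //.
  - by move=> y _; rewrite lee_fin powR_ge0.
  - by apply/measurable_EFinP; exact: (measurableT_comp (measurable_powR q') mg).
  - by apply: emeasurable_funD.
  - move=> y _; pose K := Num.truncn (g y).
    have gK : g y <= 2 * 2 ^+ K.
      apply: le_trans (ltW (truncnS_gt _)) _.
      have := ltn_expl K (leqnn 2) => h.
      have : K.+1%:R <= (2 ^ K)%:R :> R by rewrite ler_nat.
      rewrite natrX => h2; apply: (le_trans h2).
      by rewrite ler_peMl ?exprn_ge0 // ler1n.
    have := powR_le_layers q'0 (g0 y) gK; rewrite -lee_fin => h.
    apply: (le_trans h); rewrite EFinD leeD2l //.
    apply: le_trans (nneseries_lim_ge K _); last by move=> n _ _; exact: f0.
    rewrite -sumEFin big_mkord; apply: lee_sum => k _.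
    rewrite /f lee_fin /c indicE /A.
    suff -> : (y \in [set y | 2 * 2 ^+ k < g y]) = (2 * 2 ^+ k < g y) by [].
    by apply/idP/idP; rewrite inE.
apply: (le_trans le1).
rewrite ge0_integralD //; last first.
  by move=> y _; apply: nneseries_ge0 => n _ _.
rewrite integral_cst_probability EFinD leeD2l //.
rewrite integral_nneseries //.
apply: lime_le.
  apply: is_cvg_nneseries => n _ _; apply: integral_ge0 => y _; exact: f0.
apply: nearW => n.
apply: (@le_trans _ _ ((\sum_(0 <= k < n) C * r ^+ k)%:E)).
  rewrite -sumEFin; apply: lee_sum => k _.
  under eq_integral do rewrite /f EFinM.
  rewrite ge0_integralZl_EFin //; last first.
    by apply/measurable_EFinP; exact: measurable_indic.
  rewrite integral_indic_fine // probability_fineK //.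
  apply: (@le_trans _ _ ((c k)%:E * (D / (2 ^+ k) `^ q)%:E)%E).
    by apply: lee_wpmul2l; rewrite ?lee_fin //; apply: tail; rewrite exprn_gt0.
  rewrite -EFinM lee_fin /C /c.
  have -> : r ^+ k = (2 ^+ k) `^ q' / (2 ^+ k) `^ q.
    rewrite -!powR_mulrn ?powR_ge0 // -!powRrM -powRB ?pnatr_eq0 ?implybT //.
    by congr (_ `^ _); rewrite mulrC mulrBr.
  by rewrite le_eqVlt; apply/orP; left; apply/eqP; ring.
rewrite lee_fin.
apply: le_trans (geometric_le_lim n C0 r0 _); last by rewrite ger0_norm // ltW.
by rewrite /series /geometric.
Qed.

End Tails.

(** * Maximal inequalities and averages over boxes *)

Section Maximal.
Context {d : measure_display} {Y : measurableType d} {R : realType}.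
Variable (Q : probability Y R).

(** Only the averages of length at most [N] enter, so that the maximum is finite
    everywhere; all bounds below are uniform in [N]. *)
Definition max_avg (T : Y -> Y) N (f : Y -> R) y : R :=
  \big[Num.max/0]_(k < N) ((\sum_(j < k.+1) f (iter j T y)) / k.+1%:R).

Lemma max_avg_ge0 T N f y : 0 <= max_avg T N f y.
Proof. by apply/bigmax_geP; left. Qed.

Lemma measurable_max_avg T N f : measurable_fun setT T -> measurable_fun setT f ->
  measurable_fun setT (max_avg T N f).
Proof.
move=> mT mf.
pose F0 k y := (\sum_(j < k.+1) f (iter j T y)) / k.+1%:R.
have mF0 k : measurable_fun setT (F0 k).
  apply: measurable_funM => //; apply: measurable_sum => j.
  exact: (measurableT_comp mf (measurable_iter mT j)).
rewrite -[max_avg T N f]/(fun y => \big[Num.max/0]_(k < N) F0 k y).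
elim: N F0 mF0 => [|N IH] F mF.
  by under eq_fun do rewrite big_ord0; exact: measurable_cst.
under eq_fun do rewrite big_ord_recl.
by apply: measurable_maxr => //; apply: (IH (fun k => F k.+1)).
Qed.

Section OneMap.
Variable T : Y -> Y.
Hypothesis mT : measurable_fun setT T.
Hypothesis QT : forall A, measurable A -> Q (T @^-1` A) = Q A.

Lemma measurable_large_average N (lam : R) (f : Y -> R) : measurable_fun setT f ->
  measurable [set y | exists2 k, (0 < k <= N)%N & lam * k%:R < \sum_(j < k) f (iter j T y)].
Proof.
move=> mf.
rewrite [X in measurable X](_ : _ = \bigcup_(k in [set k | (0 < k <= N)%N])
   [set y | lam * k%:R < \sum_(j < k) f (iter j T y)]).
  apply: bigcup_measurable => k _; apply: measurable_gt.
  apply: measurable_sum => j.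
  exact: (measurableT_comp mf (measurable_iter mT j)).
by apply/seteqP; split => y [k]; exists k.
Qed.

(** The tiling argument for minus the Birkhoff sums, with slope [- lam]: a place
    of the orbit outside the event starts no block of average above [lam], and
    costs [w = lam]. *)
Lemma maximal_inequality N (lam D : R) (f : Y -> R) : 0 <= lam -> measurable_fun setT f ->
  (forall y, 0 <= f y) -> (\int[Q]_y (f y)%:E <= D%:E)%E ->
  lam * fine (Q [set y | exists2 k, (0 < k <= N)%N &
    lam * k%:R < \sum_(j < k) f (iter j T y)]) <= D.
Proof.
move=> lam0 mf f0 fD; have mA := measurable_large_average N lam mf.
set A := [set y | _] in mA *.
have fi : Q.-integrable setT (EFin \o f).
  apply/integrableP; split; first exact/measurable_EFinP.
  rewrite (le_lt_trans _ (ltry D)) //; apply: le_trans fD.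
  rewrite le_eqVlt; apply/orP; left; apply/eqP.
  by apply: eq_integral => y _ /=; rewrite ger0_norm.
have fD' : \int[Q]_y f y <= D.
  rewrite -lee_fin /Rintegral fineK //; exact: integrable_fin_num.
pose X n y := - \sum_(j < n) f (iter j T y).
have key : - (\int[Q]_y f y) <= - lam + \int[Q]_y (\1_(~` A) y * lam).
  apply: (@subadditive_mean_le _ _ _ Q T mT QT X (- lam) (- \int[Q]_y f y) N
    (fun=> lam) (~` A)) => //.
  - by move=> y; rewrite /X big_ord0 oppr0.
  - move=> m n y; rewrite /X -opprD lerN2 big_split_ord /= lerD2l.
    by apply: ler_sum => j _; rewrite -iterD addnC.
  - by move=> n; exact: (integrable_opp_birkhoff_sum mT QT n fi).
  - by move=> n; rewrite (Rintegral_opp_birkhoff_sum mT QT n fi).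
  - exact: finite_measure_integrable_cst.
  - by move=> y; rewrite /X big_ord1 /= addrC subrr oppr_le0.
  - exact: measurableC.
  - move=> y; rewrite /= => /contrapT[k kN Ak]; exists k => //.
    by rewrite /X mulNr lerN2 ltW.
have E : \int[Q]_y (\1_(~` A) y * lam) = lam * (1 - fine (Q A)).
  rewrite RintegralZr //; last exact: (integrable_indic _ (measurableC mA)).
  rewrite mulrC; congr (_ * _).
  rewrite /Rintegral integral_indic_fine; last exact: measurableC.
  have : Q (~` A) = (1 - fine (Q A))%:E.
    by rewrite EFinB probability_fineK // probability_setC.
  by move=> ->.
by rewrite E in key; lra.
Qed.

(** The part of [f] below [lam] contributes at most [lam] to any average, and
    the rest is controlled by the averages of [f `^ q], to which the maximal
    inequality applies at level [lam `^ q]. *)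
Lemma max_avg_tail (q D : R) N (lam : R) (f : Y -> R) :
  1 <= q -> 0 < lam -> measurable_fun setT f ->
  (forall y, 0 <= f y) -> (\int[Q]_y (f y `^ q)%:E <= D%:E)%E ->
  (Q [set y | (2 * lam < max_avg T N f y)%R] <= (D / lam `^ q)%:E)%E.
Proof.
move=> q1 lam0 mf f0 fD; pose lamq := lam `^ q.
have lq0 : 0 < lamq by exact: powR_gt0.
have mfq : measurable_fun setT (fun y => f y `^ q).
  exact: (measurableT_comp (measurable_powR q) mf).
have := @maximal_inequality N lamq D _ (ltW lq0) mfq (fun y => powR_ge0 _ _) fD.
have := measurable_large_average N lamq mfq.
set B := [set y | _] => mB QB.
have mA := measurable_gt (2 * lam) (measurable_max_avg N mT mf).
have sub : [set y | 2 * lam < max_avg T N f y] `<=` B.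
  move=> y /=; rewrite /max_avg => /bigmax_gtP[|[k _]].
    by rewrite ltNge mulr_ge0 // ltW.
  rewrite ltr_pdivlMr // => H; exists k.+1; first by rewrite /= ltn_ord.
  have : \sum_(j < k.+1) f (iter j T y) <=
      \sum_(j < k.+1) (lam + f (iter j T y) `^ q * (lam / lamq)).
    by apply: ler_sum => j _; exact: le_add_powR.
  rewrite big_split /= sumr_const card_ord -mulr_suml -[_ *+ _]mulr_natr => H2.
  set S := \sum_(j < k.+1) f _ `^ q in H2 *.
  have : lam * k.+1%:R < S * (lam / lamq) by lra.
  by rewrite mulrA ltr_pdivlMr // => H3; rewrite -(ltr_pM2l lam0); lra.
apply: (@le_trans _ _ (Q B)); first by apply: le_measure; rewrite ?inE.
rewrite -(probability_fineK Q mB) lee_fin ler_pdivlMr //.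
by rewrite mulrC.
Qed.

Lemma max_avg_moment (q q' D : R) : 1 <= q' -> q' < q -> 0 <= D ->
  exists D', forall N (f : Y -> R), measurable_fun setT f -> (forall y, 0 <= f y) ->
    (\int[Q]_y (f y `^ q)%:E <= D%:E)%E ->
    (\int[Q]_y (max_avg T N f y `^ q')%:E <= D'%:E)%E.
Proof.
move=> q'1 qq' D0.
have q'0 : 0 <= q' by lra.
have [D' HD'] := moment_of_tails Q q'0 qq' D0.
exists D' => N f mf f0 fD; apply: HD'.
- exact: measurable_max_avg.
- by move=> y; exact: max_avg_ge0.
- by move=> c c0; apply: max_avg_tail => //; lra.
Qed.

End OneMap.

Section Iterated.
Context {I : Type} (T : I -> Y -> Y).
Hypothesis mT : forall i, measurable_fun setT (T i).
Hypothesis QT : forall i A, measurable A -> Q (T i @^-1` A) = Q A.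
Implicit Types (s : seq I) (f : Y -> R).

Fixpoint orbit_sum n s f y : R :=
  if s is i :: s' then \sum_(j < n) orbit_sum n s' f (iter j (T i) y) else f y.

(** Maximal functions taken along one map after the other: they dominate the
    averages over boxes of side at most [N]. *)
Fixpoint max_avgs N s f : Y -> R :=
  if s is i :: s' then max_avg (T i) N (max_avgs N s' f) else f.

Lemma max_avgs_ge0 N s f y : (forall y, 0 <= f y) -> 0 <= max_avgs N s f y.
Proof. by case: s => [|i s] // _; exact: max_avg_ge0. Qed.

Lemma measurable_max_avgs N s f : measurable_fun setT f ->
  measurable_fun setT (max_avgs N s f).
Proof. by move=> mf; elim: s => [|i s IH] //; exact: measurable_max_avg. Qed.

Lemma measurable_orbit_sum n s f : measurable_fun setT f ->
  measurable_fun setT (orbit_sum n s f).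
Proof.
move=> mf; elim: s => [|i s IH] //=.
apply: measurable_sum => j; exact: (measurableT_comp IH (measurable_iter (mT i) j)).
Qed.

Lemma orbit_sum_le N n s f y : (0 < n <= N)%N -> (forall y, 0 <= f y) ->
  orbit_sum n s f y <= n%:R ^+ size s * max_avgs N s f y.
Proof.
move=> /andP[n0 nN] f0; elim: s y => [|i s IH] y; first by rewrite expr0 mul1r.
rewrite [orbit_sum _ _ _ _]/=.
apply: (@le_trans _ _ (\sum_(j < n) n%:R ^+ size s * max_avgs N s f (iter j (T i) y))).
  by apply: ler_sum => j _; exact: IH.
rewrite -mulr_sumr /= exprSr -mulrA ler_wpM2l ?exprn_ge0 //.
case: n n0 nN {IH} => // n _ nN.
rewrite mulrC -ler_pdivrMr ?ltr0n // /max_avg.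
exact: (le_bigmax _ (fun k : 'I_N => (\sum_(j < k.+1) _ (iter j (T i) y)) / k.+1%:R) (Ordinal nN)).
Qed.

(** Each map lowers the exponent from [q'] to the midpoint of 1 and [q'], which
    is still larger than 1. *)
Lemma max_avgs_moment s (q D : R) : 1 < q -> 0 <= D ->
  exists q' D', [/\ 1 < q', 0 <= D' & forall N f, measurable_fun setT f ->
    (forall y, 0 <= f y) -> (\int[Q]_y (f y `^ q)%:E <= D%:E)%E ->
    (\int[Q]_y (max_avgs N s f y `^ q')%:E <= D'%:E)%E].
Proof.
move=> q1 D0; elim: s => [|i s [q' [D' [q'1 D'0 H]]]]; first by exists q, D; split.
have h1 : 1 <= (1 + q') / 2 by lra.
have h2 : (1 + q') / 2 < q' by lra.
have [D2 HD2] := @max_avg_moment (T i) (mT i) (QT i) _ _ D' h1 h2 D'0.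
exists ((1 + q') / 2), (Num.max D2 0); split; first by lra.
  by rewrite le_max lexx orbT.
move=> N f mf f0 fD; have := HD2 N (max_avgs N s f) (measurable_max_avgs N s mf)
  (fun y => max_avgs_ge0 N s y f0) (H N f mf f0 fD).
by move=> h; apply: (le_trans h); rewrite lee_fin le_max lexx.
Qed.

(** The mean of [max_avgs N s f] is bounded uniformly in [N], so by Markov's
    inequality the supremum of the box averages over all sides is finite. *)
Lemma ae_bounded_orbit_averages s f (q D : R) : 1 < q -> measurable_fun setT f ->
  (forall y, 0 <= f y) -> (\int[Q]_y (f y `^ q)%:E <= D%:E)%E ->
  {ae Q, forall y, exists2 K, 0 <= K &
     forall n, (0 < n)%N -> orbit_sum n s f y <= n%:R ^+ size s * K}.
Proof.
move=> q1 mf f0 fD.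
have D0 : 0 <= D.
  rewrite -lee_fin; apply: le_trans fD; apply: integral_ge0 => y _.
  by rewrite lee_fin powR_ge0.
have [q' [D' [q'1 D'0 H]]] := max_avgs_moment s q1 D0.
have mD N : (\int[Q]_y (max_avgs N s f y)%:E <= (1 + D')%:E)%E.
  have mm := measurable_max_avgs N s mf.
  apply: (@le_trans _ _ (\int[Q]_y (1%:E + (max_avgs N s f y `^ q')%:E))%E).
    apply: ge0_le_integral => //.
    - by move=> y _; rewrite lee_fin max_avgs_ge0.
    - exact/measurable_EFinP.
    - apply/measurable_EFinP; apply: measurable_funD => //.
      exact: (measurableT_comp (measurable_powR q') mm).
    - move=> y _; have := le_add_powR (ltW q'1) ltr01 (max_avgs_ge0 N s y f0).
      by rewrite powR1 divr1 mulr1 lee_fin.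
  rewrite ge0_integralD //; last 2 first.
  - by move=> y _; rewrite lee_fin powR_ge0.
  - by apply/measurable_EFinP; exact: (measurableT_comp (measurable_powR q') mm).
  by rewrite integral_cst_probability EFinD leeD2l //; exact: H.
pose A K N := [set y | exists2 k, (0 < k <= N)%N &
  k%:R ^+ size s * K%:R < orbit_sum k s f y].
have mA K N : measurable (A K N).
  rewrite (_ : A K N = \bigcup_(k in [set k | (0 < k <= N)%N])
     [set y | k%:R ^+ size s * K%:R < orbit_sum k s f y]).
    apply: bigcup_measurable => k _; apply: measurable_gt.
    exact: measurable_orbit_sum.
  by apply/seteqP; split => y [k]; exists k.
have QA K N : (Q (A K.+1 N) <= ((1 + D') / K.+1%:R)%:E)%E.
  have mm := measurable_max_avgs N s mf.
  apply: le_trans (markov_gt (ltr0Sn R K) mm (fun y => max_avgs_ge0 N s y f0) (mD N)).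
  apply: le_measure; rewrite ?inE //; first exact: measurable_gt.
  move=> y /= [k kN Ak]; have := lt_le_trans Ak (orbit_sum_le s y kN f0).
  rewrite ltr_pM2l // exprn_gt0 // ltr0n.
  by case/andP: kN.
pose B K := \bigcup_N A K N.
have mB K : measurable (B K) by apply: bigcup_measurable.
have QB K : (Q (B K.+1) <= ((1 + D') / K.+1%:R)%:E)%E.
  have nd : nondecreasing_seq (A K.+1).
    move=> m n mn; apply/subsetPset => y [k /andP[k0 km] Ak]; exists k => //.
    by rewrite k0 (leq_trans km).
  have /cvg_lim <- // := nondecreasing_cvg_mu (mu := Q) (mA K.+1) (mB K.+1) nd.
  have cv := nondecreasing_cvg_mu (mu := Q) (mA K.+1) (mB K.+1) nd.
  apply: lime_le; last by apply: nearW => n; exact: QA.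
  by apply/cvg_ex; exists (Q (B K.+1)); exact: cv.
exists (\bigcap_K B K.+1); split.
- exact: bigcap_measurable.
- have mBi : measurable (\bigcap_K B K.+1) by exact: bigcap_measurable.
  apply/eqP; rewrite eq_le measure_ge0 andbT.
  rewrite -(probability_fineK Q mBi) lee_fin leNgt; apply/negP => p0.
  set p := fine _ in p0.
  have [K HK] : exists K, (1 + D') / p < K.+1%:R.
    by exists (Num.truncn ((1 + D') / p)); exact: truncnS_gt.
  have : (p%:E <= ((1 + D') / K.+1%:R)%:E)%E.
    rewrite /p probability_fineK //; apply: le_trans (QB K).
    by apply: le_measure; rewrite ?inE // => y; apply.
  rewrite lee_fin leNgt => /negP; apply.
  by rewrite ltr_pdivrMr ?ltr0n // mulrC -ltr_pdivrMr.
- move=> y /= Hy K _; apply: contrapT => nB; apply: Hy.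
  exists K.+1%:R => // n n0; rewrite leNgt; apply/negP => An; apply: nB.
  by exists n => //; exists n => //; rewrite n0 leqnn.
Qed.

End Iterated.
End Maximal.

(** * The asymptotic seminorm of a subadditive function *)

Section AsymptoticSeminorm.
Context {R : realType}.

Lemma le_of_le_linear (p q c : R) : (forall n : nat, p * n%:R <= q * n%:R + c) -> p <= q.
Proof.
move=> H; rewrite leNgt; apply/negP => qp.
have D0 : 0 < p - q by rewrite subr_gt0.
have := truncnS_gt (c / (p - q)); set n := _.+1.
by rewrite ltr_pdivrMr // => h; have := H n; lra.
Qed.

Context {V : normedModType R}.
Variables (a : V -> R) (C : R).
Hypothesis a_ge0 : forall x, 0 <= a x.
Hypothesis aN : forall x, a (- x) = a x.
Hypothesis aD : forall x y, a (x + y) <= a x + a y.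
Hypothesis aC : forall x, a x <= C * (`|x| + 1).

Definition asymp (x : V) : R := inf [set a (x *+ n.+1) / n.+1%:R | n in [set: nat]].

Let has_inf_asymp x : has_inf [set a (x *+ n.+1) / n.+1%:R | n in [set: nat]].
Proof.
split; first by exists (a (x *+ 1) / 1), 0%N.
by exists 0 => _ [n _ <-]; rewrite divr_ge0.
Qed.

Lemma asymp_ge0 x : 0 <= asymp x.
Proof.
apply: lb_le_inf; first by case: (has_inf_asymp x).
by move=> _ [n _ <-]; rewrite divr_ge0.
Qed.

Lemma asymp_le n x : asymp x * n%:R <= a (x *+ n).
Proof.
case: n => [|n]; first by rewrite mulr0.
rewrite -ler_pdivlMr ?ltr0n //; apply: ge_inf; last by exists n.
by case: (has_inf_asymp x).
Qed.

Lemma subadditive_mulrn_le n x : a (x *+ n) <= n%:R * a x + a 0.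
Proof.
elim: n => [|n IH]; first by rewrite mulr0n mul0r add0r.
by rewrite mulrS (le_trans (aD _ _)) // -natr1 mulrDl mul1r; lra.
Qed.

(** Fekete's lemma: divide [n] by a [k.+1] that almost attains the infimum. *)
Lemma asymp_ub x (e : R) : 0 < e ->
  exists c, forall n, a (x *+ n) <= (asymp x + e) * n%:R + c.
Proof.
move=> e0; have [_ [k _ <-] Hk] := inf_adherent e0 (has_inf_asymp x).
rewrite -/(asymp x) in Hk.
set K := k.+1 in Hk; have K0 : 0 < K%:R :> R by rewrite ltr0n.
have b0 : 0 <= asymp x + e by have := asymp_ge0 x; lra.
exists (K%:R * a x + 2 * a 0) => n.
rewrite ltr_pdivrMr // in Hk.
rewrite {1}(divn_eq n K) mulrnDr mulnC mulrnA.
apply: (le_trans (aD _ _)).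
have h1 := subadditive_mulrn_le (n %/ K) (x *+ K).
have h2 := subadditive_mulrn_le (n %% K) x.
have h3 : (n %% K)%:R * a x <= K%:R * a x.
  by rewrite ler_wpM2r // ler_nat ltnW // ltn_mod.
have h4 : (n %/ K)%:R * a (x *+ K) <= (n %/ K)%:R * ((asymp x + e) * K%:R).
  by rewrite ler_wpM2l // ltW.
have h5 : (n %/ K)%:R * ((asymp x + e) * K%:R) <= (asymp x + e) * n%:R.
  rewrite mulrCA ler_wpM2l // -natrM ler_nat; exact: leq_trunc_div.
lra.
Qed.

(** Convergence of [a (x *+ n) / n] is expressed by errors [e * n%:R + c]: the
    constant [c] absorbs every bounded perturbation of [a (x *+ n)]. *)
Lemma asymp_unique x (l : R) :
  (forall e : R, 0 < e -> exists c, forall n, `|a (x *+ n) - l * n%:R| <= e * n%:R + c) ->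
  asymp x = l.
Proof.
move=> H; apply/eqP; rewrite eq_le; apply/andP; split; apply/ler_addgt0Pr => e e0.
  have [c Hc] := H e e0; apply: (@le_of_le_linear _ _ c) => n.
  have := asymp_le n x; have := Hc n; rewrite ler_norml => /andP[_]; lra.
have e20 : 0 < e / 2 by lra.
have [c Hc] := H _ e20; have [c' Hc'] := asymp_ub x e20.
apply: (@le_of_le_linear _ _ (c + c')) => n.
have := Hc' n; have := Hc n; rewrite ler_norml => /andP[+ _]; lra.
Qed.

Lemma asymp_approx x (e : R) : 0 < e ->
  exists c, forall n, `|a (x *+ n) - asymp x * n%:R| <= e * n%:R + c.
Proof.
move=> e0; have [c Hc] := asymp_ub x e0; exists `|c| => n.
have := Hc n; have := asymp_le n x; have := ler_norm c.
have : 0 <= e * n%:R by rewrite mulr_ge0 // ltW.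
rewrite ler_norml => ? ? ? ?; apply/andP; split; lra.
Qed.

Lemma asympD x y : asymp (x + y) <= asymp x + asymp y.
Proof.
apply/ler_addgt0Pr => e e0; have e20 : 0 < e / 2 by lra.
have [c Hc] := asymp_ub x e20; have [c' Hc'] := asymp_ub y e20.
apply: (@le_of_le_linear _ _ (c + c')) => n.
have := asymp_le n (x + y); rewrite mulrnDl.
have := aD (x *+ n) (y *+ n); have := Hc n; have := Hc' n; lra.
Qed.

Lemma asympN x : asymp (- x) = asymp x.
Proof.
rewrite /asymp; congr inf; apply/seteqP; split => _ [n _ <-]; exists n => //.
  by rewrite mulNrn aN.
by rewrite mulNrn aN.
Qed.

Let C_ge0 : 0 <= C.
Proof. by have := aC 0; have := a_ge0 0; rewrite normr0; lra. Qed.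

Let a_dist x y : `|a x - a y| <= a (x - y).
Proof.
have h1 := aD (x - y) y; have h2 := aD (y - x) x.
rewrite subrK in h1; rewrite subrK -[y - x]opprB aN in h2.
by rewrite ler_norml; apply/andP; split; lra.
Qed.

(** For [t] nonnegative, [n t x] differs from [m x], with [m] the integral part
    of [n t], by a vector no longer than [x], on which [a] is bounded. *)
Lemma asympZ (t : R) x : asymp (t *: x) = `|t| * asymp x.
Proof.
have pos (l : R) : 0 <= l -> asymp (l *: x) = l * asymp x.
  move=> l0; apply: asymp_unique => e e0.
  have e'0 : 0 < e / (l + 1) by rewrite divr_gt0 //; lra.
  have [c Hc] := asymp_approx x e'0.
  exists (`|c| + C * (`|x| + 1) + asymp x) => n.
  pose m := Num.truncn (l * n%:R).
  have ln0 : 0 <= l * n%:R by rewrite mulr_ge0.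
  have m_le : m%:R <= l * n%:R by have /andP[] := truncn_itv ln0.
  have lt_m : l * n%:R < m.+1%:R by exact: truncnS_gt.
  rewrite -natr1 in lt_m.
  have h1 : `|a ((l *: x) *+ n) - a (x *+ m)| <= C * (`|x| + 1).
    apply: (le_trans (a_dist _ _)).
    have -> : (l *: x) *+ n - x *+ m = (l * n%:R - m%:R) *: x.
      by rewrite scalerBl mulrC -scalerA !scaler_nat.
    apply: (le_trans (aC _)); rewrite ler_wpM2l // lerD2r normrZ.
    by rewrite ler_piMl // ger0_norm; lra.
  have h2 := Hc m.
  have h3 : e / (l + 1) * m%:R <= e * n%:R.
    rewrite mulrAC ler_pdivrMr ?ltr_wpDl //.
    apply: (@le_trans _ _ (e * (l * n%:R))); first by rewrite ler_wpM2l // ltW.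
    have : 0 <= e * n%:R by rewrite mulr_ge0 // ltW.
    by lra.
  have h4 : `|asymp x * m%:R - l * asymp x * n%:R| <= asymp x.
    have -> : asymp x * m%:R - l * asymp x * n%:R = asymp x * (m%:R - l * n%:R) by ring.
    rewrite normrM ger0_norm ?asymp_ge0 // ler_piMr ?asymp_ge0 //.
    by rewrite ler_norml; apply/andP; split; lra.
  have h5 := ler_norm c.
  move: h1 h2 h4; rewrite !ler_norml => /andP[? ?] /andP[? ?] /andP[? ?].
  by apply/andP; split; lra.
have [t0|t0] := leP 0 t; first by rewrite pos // ger0_norm.
by rewrite -asympN -scaleNr pos ?ltr0_norm // oppr_ge0 ltW.
Qed.

Lemma asymp_le_norm x : asymp x <= C * `|x|.
Proof.
apply: (@le_of_le_linear _ _ C) => n.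
apply: (le_trans (asymp_le n x)); apply: (le_trans (aC _)).
by rewrite normrMn -mulr_natl; lra.
Qed.

End AsymptoticSeminorm.

(** * The law of the field on path space *)

Section PathSpace.
Context {R : realType} {d : nat}.

(** A copy of the path space, to be given the pointed structure that
    [g_sigma_algebraType] asks for. *)
Definition path_type := path_space R d.

HB.instance Definition _ := gen_eqMixin path_type.
HB.instance Definition _ := gen_choiceMixin path_type.
HB.instance Definition _ := isPointed.Build path_type (fun _ _ => 0%R%:nng).

Definition paths := g_sigma_algebraType (@cylinders R d : set (set path_type)).

Definition translate (z : 'rV[R]_d) (p : paths) : paths := theta (- z) p.

Lemma translateE z p x y : translate z p x y = p (x + z) (y + z).
Proof. by rewrite /translate /theta !opprK. Qed.

Lemma translateD y z p : translate y (translate z p) = translate (y + z) p.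
Proof.
by apply/funext => a; apply/funext => b; rewrite !translateE !addrA.
Qed.

Lemma translate0 p : translate 0 p = p.
Proof. by apply/funext => a; apply/funext => b; rewrite !translateE !addr0. Qed.

Lemma iter_translate n z p : iter n (translate z) p = translate (z *+ n) p.
Proof.
elim: n => [|n IH]; first by rewrite mulr0n translate0.
by rewrite iterS IH translateD mulrS.
Qed.

Lemma measurable_coord x y : measurable_fun setT (fun p : paths => (p x y)%:num).
Proof.
move=> _ B mB; rewrite setTI; apply: sub_sigma_algebra.
by exists x, y, B.
Qed.

Lemma measurable_to_paths disp (T : measurableType disp) (f : T -> paths) :
  (forall x y, measurable_fun setT (fun w => (f w x y)%:num)) -> measurable_fun setT f.
Proof.
move=> mf; apply: (@measurability _ _ T paths setT f (@cylinders R d : set (set paths)) erefl).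
move=> _ [_ [x [y [B [mB ->]]]] <-].
exact: (mf x y measurableT B mB).
Qed.

Lemma measurable_translate z : measurable_fun setT (translate z).
Proof.
apply: measurable_to_paths => x y.
under eq_fun do rewrite translateE; exact: measurable_coord.
Qed.

End PathSpace.
Arguments paths : clear implicits.

Section Law.
Context {R : realType} {disp : measure_display} {T : measurableType disp} {d : nat}.
Variables (P : probability T R) (tau : T -> path_space R d).
Hypothesis mtau : forall x y, measurable_fun setT (fun w => (tau w x y)%:num).

Let mtau' : measurable_fun setT (tau : T -> paths R d) := measurable_to_paths mtau.

Definition tau_fun : T -> paths R d := tau.
HB.instance Definition _ := isMeasurableFun.Build _ _ _ _ tau_fun mtau'.
Definition law : probability (paths R d) R := distribution P tau_fun.


(** An almost sure property for the law of the field need not be a measurable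
    event of the path space: only a measurable null set is pulled back. *)
Lemma ae_law (A : paths R d -> Prop) :
  {ae law, forall p, A p} -> {ae P, forall w, A (tau w)}.
Proof.
move=> [N [mN N0 sub]]; exists (tau_fun @^-1` N); split => //.
  by rewrite -[X in measurable X]setTI; exact: mtau'.
by move=> w /= Aw; apply: (sub (tau w)).
Qed.

Lemma ge0_integral_law (f : paths R d -> \bar R) : measurable_fun setT f ->
  (forall p, 0 <= f p)%E -> (\int[law]_p f p = \int[P]_w f (tau w))%E.
Proof. exact: (ge0_integral_distribution tau_fun). Qed.

Lemma measurable_comp_tau d' (U : measurableType d') (f : paths R d -> U) :
  measurable_fun setT f -> measurable_fun setT (fun w => f (tau w)).
Proof. by move=> mf; exact: (measurableT_comp mf mtau'). Qed.

Hypothesis tau_stat : stationary P tau.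

Lemma law_translate z A : measurable A -> law (translate z @^-1` A) = law A.
Proof. by move=> mA; exact: (tau_stat (- z) mA). Qed.

Lemma ge0_integral_translate z (f : paths R d -> \bar R) : measurable_fun setT f ->
  (forall p, 0 <= f p)%E ->
  (\int[P]_w f (translate z (tau w)) = \int[P]_w f (tau w))%E.
Proof.
move=> mf f0; have mfz : measurable_fun setT (f \o translate z).
  exact: (measurableT_comp mf (measurable_translate z)).
rewrite -(ge0_integral_law mf f0) -(ge0_integral_law mfz) //; last by move=> p /=.
exact: (ge0_integral_iter (measurable_translate z) (law_translate z) 1).
Qed.

Hypothesis tau_erg : ergodic P tau.

Lemma law_ergodic z A : z != 0 -> measurable A -> translate z @^-1` A = A ->
  law A = 0%E \/ law A = 1%E.
Proof.
move=> z0 mA zA; apply: (tau_erg.2 z A z0 mA).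
have E p : translate z (theta z p) = p.
  by apply/funext => x; apply/funext => y; rewrite translateE /theta !addrK.
have E' p : theta z (translate z p) = p.
  by apply/funext => x; apply/funext => y; rewrite /theta translateE !subrK.
apply/seteqP; split => [_ [p Ap <-]|p Ap].
  by rewrite -zA /= E.
exists (translate z p); last exact: E'.
by move: Ap; rewrite -{1}zA.
Qed.

End Law.

(** * Means *)

Section Mean.
Context {R : realType} {disp : measure_display} {T : measurableType disp} {d : nat}.
Variables (P : probability T R) (tau : T -> path_space R d).
Hypothesis tau_pseudo : random_pseudometric P tau.
Hypothesis tau_stat : stationary P tau.
Hypothesis tau_max : stationary_unit_max P tau.
Variable p : R.
Hypothesis p1 : 1 <= p.
Hypothesis moment : (\int[P]_w (unit_max (tau w) `^ p) < +oo)%E.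

Let mtau := tau_pseudo.1.

Lemma theta0 (q : path_space R d) : theta 0 q = q.
Proof. by apply/funext => a; apply/funext => b; rewrite /theta !subr0. Qed.

Lemma measurable_unit_max : measurable_fun setT (fun w => unit_max (tau w)).
Proof.
have [+ _] := tau_max 0.
by under eq_fun do rewrite theta0.
Qed.

Lemma le_unit_max (q : path_space R d) x : `|x| <= 1 ->
  ((q 0 x)%:num%:E <= unit_max q)%E.
Proof. by move=> x1; apply: ereal_sup_ubound; exists x. Qed.

Lemma unit_max_ge0 (q : path_space R d) : (0 <= unit_max q)%E.
Proof.
apply: le_trans (le_unit_max q (x := 0) _); last by rewrite normr0.
by rewrite lee_fin.
Qed.

Lemma integral_unit_max_fin : (\int[P]_w unit_max (tau w))%E \is a fin_num.
Proof.
have mU := measurable_unit_max.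
rewrite ge0_fin_numE; last by apply: integral_ge0 => w _; exact: unit_max_ge0.
apply: (@le_lt_trans _ _ (\int[P]_w (1%:E + unit_max (tau w) `^ p))%E).
  apply: ge0_le_integral => //.
  - by move=> w _; exact: unit_max_ge0.
  - apply: emeasurable_funD => //.
    exact: (measurableT_comp (measurable_poweR p) mU).
  - move=> w _; have := unit_max_ge0 (tau w).
    case: (unit_max (tau w)) => [r| |] //.
      rewrite lee_fin => r0; rewrite poweR_EFin -EFinD lee_fin.
      by have := le_add_powR p1 ltr01 r0; rewrite powR1 divr1 mulr1.
    move=> _; rewrite poweRyr ?addey ?leey //.
    by rewrite gt_eqF // (lt_le_trans ltr01).
rewrite ge0_integralD //; last 2 first.
- by move=> w _; exact: poweR_ge0.
- exact: (measurableT_comp (measurable_poweR p) mU).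
by rewrite integral_cst_probability lte_add_pinfty // ltry.
Qed.

Definition emean (x : 'rV[R]_d) : \bar R := (\int[P]_w ((tau w 0 x)%:num)%:E)%E.

Let mcoord x y : measurable_fun setT (fun w => ((tau w x y)%:num)%:E).
Proof. by apply/measurable_EFinP; exact: mtau. Qed.

Lemma emean_ge0 x : (0 <= emean x)%E.
Proof. by apply: integral_ge0 => w _; rewrite lee_fin. Qed.

Lemma emean_translate z x : (\int[P]_w ((tau w z (z + x))%:num)%:E = emean x)%E.
Proof.
have mf : measurable_fun setT (fun q : paths R d => ((q 0 x)%:num)%:E).
  apply/measurable_EFinP; exact: measurable_coord.
have := ge0_integral_translate mtau tau_stat z mf (fun q => ltac:(by rewrite lee_fin)).
under eq_integral do rewrite translateE add0r addrC.
by [].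
Qed.

Lemma emeanN x : emean (- x) = emean x.
Proof.
rewrite -(emean_translate x (- x)) subrr; apply: ae_eq_integral => //.
apply: filterS tau_pseudo.2 => w [_ sym _] _.
by rewrite sym.
Qed.

Lemma emeanD x y : (emean (x + y) <= emean x + emean y)%E.
Proof.
rewrite -(emean_translate x y) /emean -ge0_integralD //.
apply: ae_ge0_le_integral => //.
- by move=> w _; rewrite adde_ge0 // lee_fin.
- exact: emeasurable_funD.
apply: filterS tau_pseudo.2 => w [_ _ tri] _.
by rewrite -EFinD lee_fin.
Qed.

Lemma emean0 : emean 0 = 0%E.
Proof.
transitivity (\int[P]_w (0 : R)%:E)%E; last exact: integral_cst_probability.
apply: ae_eq_integral => //.
by apply: filterS tau_pseudo.2 => w [-> _ _] _.
Qed.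

Lemma emean_mulrn x n : (emean (x *+ n) <= n%:R%:E * emean x)%E.
Proof.
elim: n => [|n IH]; first by rewrite mulr0n mul0e emean0.
rewrite mulrSr (le_trans (emeanD _ _)) // -natr1 EFinD ge0_muleDl ?lee_fin //.
by rewrite mul1e leeD2r.
Qed.

Definition unit_mean : R := fine (\int[P]_w unit_max (tau w))%E.

(** The segment from 0 to [x] is cut into steps of norm at most 1. *)
Lemma emean_le x : (emean x <= (unit_mean * (`|x| + 1))%:E)%E.
Proof.
pose n := (Num.truncn `|x|).+1.
have n0 : 0 < n%:R :> R by rewrite ltr0n.
pose y := n%:R^-1 *: x.
have xy : x = y *+ n by rewrite -scaler_nat scalerA divff ?scale1r // gt_eqF.
have y1 : `|y| <= 1.
  rewrite normrZ gtr0_norm ?invr_gt0 // mulrC ler_pdivrMr // mul1r ltW //.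
  exact: truncnS_gt.
rewrite {1}xy; apply: le_trans (emean_mulrn y n) _.
have h1 : (emean y <= unit_mean%:E)%E.
  rewrite /unit_mean fineK ?integral_unit_max_fin //.
  apply: ge0_le_integral => //.
  - exact: measurable_unit_max.
  - by move=> w _; exact: le_unit_max.
apply: (@le_trans _ _ (n%:R%:E * unit_mean%:E)%E).
  by apply: lee_wpmul2l => //; rewrite lee_fin.
rewrite -EFinM lee_fin mulrC ler_wpM2l //.
  by rewrite fine_ge0 // integral_ge0 // => w _; exact: unit_max_ge0.
rewrite /n -natr1 lerD2r.
by have /andP[] := truncn_itv (normr_ge0 x).
Qed.

Definition mean x : R := fine (emean x).

Lemma meanE x : (mean x)%:E = emean x.
Proof.
rewrite /mean fineK // ge0_fin_numE ?emean_ge0 //.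
by rewrite (le_lt_trans (emean_le x)) // ltry.
Qed.

Lemma mean_ge0 x : 0 <= mean x.
Proof. by rewrite -lee_fin meanE emean_ge0. Qed.

Lemma meanN x : mean (- x) = mean x.
Proof. by rewrite /mean emeanN. Qed.

Lemma meanD x y : mean (x + y) <= mean x + mean y.
Proof. by rewrite -lee_fin EFinD !meanE emeanD. Qed.

Lemma mean_le x : mean x <= unit_mean * (`|x| + 1).
Proof. by rewrite -lee_fin meanE emean_le. Qed.

End Mean.

(** * Limits along directions *)

Section Countable.
Context {dd : measure_display} {Y : measurableType dd} {R : realType} {U : countType}.

Lemma measurable_forall (A : U -> set Y) : (forall i, measurable (A i)) ->
  measurable [set y | forall i, A i y].
Proof.
move=> mA; rewrite (_ : [set y | _] = ~` \bigcup_i ~` A i).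
  apply: measurableC; apply: countable_bigcupT_measurable; first exact: countableP.
  by move=> i; exact: measurableC.
by rewrite setC_bigcup; apply/seteqP; split => y Hy i; have := Hy i; rewrite ?setCK // => /(_ I).
Qed.

Lemma ae_forall (Q : {measure set Y -> \bar R}) (A : U -> Y -> Prop) :
  (forall i, {ae Q, forall y, A i y}) -> {ae Q, forall y i, A i y}.
Proof.
move=> H; pose A' n y := if unpickle n is Some i then A i y else True.
have : {ae Q, forall y n, A' n y}.
  apply: ae_foralln => n; rewrite /A'; case: (unpickle n) => [i|] //.
  exact: aeW.
by apply: filterS => y Hy i; have := Hy (pickle i); rewrite /A' pickleK.
Qed.
End Countable.

Section Directions.
Context {R : realType} {disp : measure_display} {T : measurableType disp} {d : nat}.
Variables (P : probability T R) (tau : T -> path_space R d).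
Hypothesis tau_pseudo : random_pseudometric P tau.
Hypothesis tau_erg : ergodic P tau.
Hypothesis tau_max : stationary_unit_max P tau.
Variable p : R.
Hypothesis p1 : 1 <= p.
Hypothesis moment : (\int[P]_w (unit_max (tau w) `^ p) < +oo)%E.

Let mtau := tau_pseudo.1.
Let tau_stat := tau_erg.1.
Let a := mean P tau.
Let aE x := meanE tau_pseudo tau_stat tau_max p1 moment x.
Notation mu := (asymp (mean P tau)).
Notation Q := (law P mtau).

Let mu_le n x : mu x * n%:R <= a (x *+ n).
Proof. exact: (asymp_le (mean_ge0 tau_pseudo tau_stat tau_max p1 moment)). Qed.

Lemma integral_law_coord x :
  (\int[Q]_q ((q 0%R x)%:num)%:E = (a x)%:E)%E.
Proof.
rewrite ge0_integral_law ?aE //; first by apply/measurable_EFinP; exact: measurable_coord.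
Qed.

Lemma integrable_law_coord x :
  Q.-integrable setT (EFin \o (fun q : paths R d => (q 0 x)%:num)).
Proof.
apply/integrableP; split; first by apply/measurable_EFinP; exact: measurable_coord.
under eq_integral do rewrite /= ger0_norm //.
by rewrite integral_law_coord ltry.
Qed.

Section OneDirection.
Variable v : 'rV[R]_d.
Hypothesis v0 : v != 0.

(** To be a pseudometric on the whole space is a condition on uncountably many
    coordinates. On the multiples of [v] it is a measurable event, invariant
    under the translation by [v], off which the field can be replaced by 0 to
    make it subadditive everywhere. *)
Definition line_metric : set (paths R d) :=
  [set q | forall t : int * int * int,
    (q (v *~ t.1.1) (v *~ t.1.1))%:num <= 0 /\
    (q (v *~ t.1.1) (v *~ t.1.2))%:num <=
    (q (v *~ t.1.1) (v *~ t.2))%:num + (q (v *~ t.2) (v *~ t.1.2))%:num].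

Lemma measurable_line_metric : measurable line_metric.
Proof.
apply: (@measurable_forall _ (paths R d)) => -[[i j] k] /=.
have mc x y := @measurable_coord R d x y.
apply: (@measurableI _ (paths R d)); rewrite -[X in measurable X]setTI.
  by apply: measurable_fun_le.
by apply: measurable_fun_le => //; apply: measurable_funD.
Qed.


Lemma line_metric_translate m (q : paths R d) :
  line_metric (translate (v *+ m) q) <-> line_metric q.
Proof.
have E (i k : int) : v *~ i + v *~ k = v *~ (i + k) by rewrite mulrzDr.
split => H [[i j] k] /=.
  have := H (i - m%:Z, j - m%:Z, k - m%:Z) => /=.
  by rewrite !translateE pmulrn !E !subrK.
have := H (i + m%:Z, j + m%:Z, k + m%:Z) => /=.
by rewrite !translateE pmulrn !E.
Qed.

Let X n (q : paths R d) : R := \1_line_metric q * (q 0 (v *+ n))%:num.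

Let mX n : measurable_fun setT (X n).
Proof.
apply: measurable_funM; last exact: measurable_coord.
exact: (measurable_indic measurable_line_metric).
Qed.

Let X_ge0 n q : 0 <= X n q.
Proof. by rewrite /X mulr_ge0 // indicE. Qed.

Let Xtau : {ae P, forall w, forall n, X n (tau w) = (tau w 0 (v *+ n))%:num}.
Proof.
apply: filterS tau_pseudo.2 => w [h0 _ tri] n; rewrite /X indicE mem_set ?mul1r //.
by move=> t; rewrite h0; split.
Qed.

Lemma direction_lower e : 0 < e ->
  {ae P, forall w, \forall n \near \oo, (mu v - e) * n%:R <= (tau w 0 (v *+ n))%:num}.
Proof.
move=> e0.
have : {ae Q, forall q, \forall n \near \oo, (mu v - e) * n%:R <= X n q}.
  apply: (subadditive_liminf_ge (measurable_translate v) (law_translate mtau tau_stat v)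
    (fun A => law_ergodic mtau tau_erg v0) (g := mu v)).
  - move=> q; rewrite /X indicE; case: (boolP (q \in _)); last by rewrite mul0r.
    by rewrite inE mul1r => /(_ (0, 0, 0)) /=; rewrite !mulr0z mulr0n => -[].
  - move=> m n q; rewrite iter_translate /X !indicE.
    have -> : (translate (v *+ m) q \in line_metric) = (q \in line_metric).
      apply/idP/idP; rewrite !inE => ?; first by apply: (line_metric_translate _ _).1; eassumption.
      by apply/line_metric_translate.
    case: (boolP (q \in _)); last by rewrite !mul0r addr0.
    rewrite inE !mul1r => /(_ (0, (m + n)%:Z, m%:Z)) /= [_].
    rewrite translateE add0r mulr0z -!pmulrn.
    by rewrite -mulrnDr [(n + m)%N]addnC.
  - move=> n; apply: (le_integrable measurableT _ _ (integrable_law_coord (v *+ n))).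
      exact/measurable_EFinP.
    move=> q _ /=; rewrite lee_fin !ger0_norm // /X indicE.
    by rewrite ler_piMl //; case: (_ \in _).
  - move=> n; rewrite -lee_fin /Rintegral.
    have -> : (\int[Q]_q (X n q)%:E = (a (v *+ n))%:E)%E.
      rewrite ge0_integral_law ?aE //; last 2 first.
      - exact/measurable_EFinP.
      - by move=> q; rewrite lee_fin.
      apply: ae_eq_integral => //.
      + by apply/measurable_EFinP; exact: (measurable_comp_tau mtau (mX n)).
      + by apply/measurable_EFinP; exact: mtau.
      by apply: filterS Xtau => w Hw _; rewrite Hw.
    by rewrite lee_fin; exact: mu_le.
  - by rewrite ltrBlDr ltrDl.
move=> /ae_law H; move: Xtau H; apply: filterS2 => w Hw.
by apply: filterS => n; rewrite Hw.
Qed.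

(** Birkhoff's theorem for the translation by [v *+ k], which is ergodic like
    all translations, and the triangle inequality along the multiples of
    [v *+ k]. *)
Lemma direction_upper k e : (0 < k)%N -> 0 < e ->
  {ae P, forall w, \forall n \near \oo,
     (tau w 0 (v *+ (k * n)))%:num <= (a (v *+ k) + e) * n%:R}.
Proof.
move=> k0 e0.
have vk0 : v *+ k != 0 by rewrite -scaler_nat scaler_eq0 pnatr_eq0 negb_or -lt0n k0.
have : {ae Q, forall q, \forall n \near \oo,
    \sum_(j < n) (iter j (translate (v *+ k)) q 0 (v *+ k))%:num <= (a (v *+ k) + e) * n%:R}.
  apply: (birkhoff_average_le (measurable_translate (v *+ k)) (law_translate mtau tau_stat (v *+ k))
    (fun A => law_ergodic mtau tau_erg vk0) (f := fun q => (q 0 (v *+ k))%:num)).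
    exact: integrable_law_coord.
  by rewrite /Rintegral integral_law_coord /= ltrDl.
move=> /ae_law H; move: tau_pseudo.2 H; apply: filterS2 => w [h0 _ tri].
apply: filterS => n; apply: le_trans.
elim: n => [|n IH]; first by rewrite muln0 mulr0n h0 big_ord0.
rewrite big_ord_recr /= mulnS [(k + _)%N]addnC mulrnDr.
apply: le_trans (tri _ _ (v *+ (k * n))) _.
by rewrite lerD // iter_translate translateE add0r -mulrnA [v *+ k + _]addrC.
Qed.

End OneDirection.

(** Along powers of 2 the upper bound for steps [v *+ 2 ^ i] suffices, since
    [2 ^ i] divides [2 ^ m] as soon as [i <= m]. *)
Lemma ae_dyadic_limit v e : 0 < e ->
  {ae P, forall w, \forall m \near \oo,
    `|(tau w 0 (v *+ 2 ^ m))%:num - mu v * (2 ^ m)%:R| <= e * (2 ^ m)%:R}.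
Proof.
move=> e0.
have [->|v0] := eqVneq v 0.
  apply: filterS tau_pseudo.2 => w [h0 _ _]; apply: nearW => m.
  have -> : mu (0 : 'rV[R]_d) = 0.
    have := asympZ (mean_ge0 tau_pseudo tau_stat tau_max p1 moment)
      (meanN tau_pseudo tau_stat) (meanD tau_pseudo tau_stat tau_max p1 moment)
      (mean_le tau_pseudo tau_stat tau_max p1 moment) 0 (0 : 'rV[R]_d).
    by rewrite scale0r normr0 mul0r.
  by rewrite mul0rn h0 mul0r subr0 normr0 mulr_ge0 // ltW.
have e30 : 0 < e / 3 by lra.
have [c Hc] := asymp_ub (mean_ge0 tau_pseudo tau_stat tau_max p1 moment)
   (meanD tau_pseudo tau_stat tau_max p1 moment) v e30.
(* The step [2 ^ i] is so long that [c] is negligible. *)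
pose i := (Num.truncn (c / (e / 3))).+1.
have ci : c <= e / 3 * (2 ^ i)%:R.
  rewrite -ler_pdivrMl // mulrC; apply: le_trans (ltW (truncnS_gt _)) _.
  by rewrite ler_nat ltnW // ltn_expl.
have i1 : 1 <= (2 ^ i)%:R :> R by rewrite ler1n expn_gt0.
have i0 : (0 < 2 ^ i)%N by rewrite expn_gt0.
have low := direction_lower v0 e0.
have up := direction_upper v0 i0 e30.
move: low up; apply: filterS2 => w [n1 _ low] [n2 _ up].
exists (maxn n1 (n2 + i)) => // m /=; rewrite geq_max => /andP[mn1 mn2].
have m2 : (m <= 2 ^ m)%N by rewrite ltnW // ltn_expl.
have l1 := low (2 ^ m)%N (leq_trans mn1 m2).
have im : (i <= m)%N by rewrite (leq_trans _ mn2) // leq_addl.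
have n2m : (n2 <= 2 ^ (m - i))%N.
  apply: (@leq_trans (m - i)); last by rewrite ltnW // ltn_expl.
  by rewrite leq_subRL // addnC.
have := up _ n2m; rewrite -expnD subnKC // => u1.
have Em : (2 ^ m)%:R = (2 ^ i)%:R * (2 ^ (m - i))%:R :> R.
  by rewrite -natrM -expnD subnKC.
set q := (2 ^ (m - i))%:R in Em u1.
have q0 : 0 <= q by [].
have h := Hc (2 ^ i)%N.
have h2 : (a (v *+ 2 ^ i) + e / 3) * q <= (mu v + e) * (2 ^ m)%:R.
  rewrite Em mulrA ler_wpM2r //.
  by move: h; rewrite -/a; nra.
rewrite ler_norml; apply/andP; split; lra.
Qed.

End Directions.

(** * Lattice averages and growth of the local maxima *)

Section FiniteUnion.
Context {dd : measure_display} {Y : measurableType dd} {R : realType}.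

Lemma measure_exists_le (Q : {measure set Y -> \bar R}) (U : eqType) (s : seq U)
    (A : U -> set Y) (c : R) :
  (forall i, measurable (A i)) -> (forall i, (Q (A i) <= c%:E)%E) ->
  measurable [set y | exists2 i, i \in s & A i y] /\
  (Q [set y | exists2 i, i \in s & A i y] <= ((size s)%:R * c)%:E)%E.
Proof.
move=> mA Ac; elim: s => [|i s [mI IH]].
  rewrite (_ : [set y | _] = set0) ?measure0 ?mul0r; first by split.
  by apply/seteqP; split => y // [].
rewrite (_ : [set y | _] = A i `|` [set y | exists2 j, j \in s & A j y]).
  split; first exact: measurableU.
  apply: le_trans (measureU2 _ (mA i) mI) _.
  by rewrite /= -natr1 mulrDl mul1r addrC EFinD leeD.
apply/seteqP; split => y /=.
  by move=> [j]; rewrite inE => /predU1P[->|js] Aj; [left|right; exists j].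
by move=> [Ai|[j js Aj]]; [exists i => //; rewrite mem_head|exists j => //; rewrite inE js orbT].
Qed.

End FiniteUnion.

Lemma orbit_sum_translate {R : realType} {d : nat} {I : eqType} (u : I -> 'rV[R]_d) n s
    (f : paths R d -> R) z q :
  orbit_sum (fun i => translate (u i)) n s f (translate z q) =
  box_sum u n s (fun x => f (translate x q)) z.
Proof.
elim: s z => [|i s IH] z //=.
apply: eq_bigr => j _; rewrite iter_translate translateD IH.
by rewrite [u i *+ j + z]addrC.
Qed.

Section LatticeFields.
Context {R : realType} {disp : measure_display} {T : measurableType disp} {d : nat}.
Variables (P : probability T R) (tau : T -> path_space R d).
Hypothesis tau_pseudo : random_pseudometric P tau.
Hypothesis tau_stat : stationary P tau.
Hypothesis tau_max : stationary_unit_max P tau.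
Variable p : R.
Hypothesis p1 : 1 <= p.
Hypothesis moment : (\int[P]_w (unit_max (tau w) `^ p) < +oo)%E.
Context {I : finType}.
Variable u : I -> 'rV[R]_d.
Hypothesis u1 : forall i, `|u i| <= 1.

Let mtau := tau_pseudo.1.
Let D := fine (\int[P]_w (unit_max (tau w) `^ p))%E.

Let p0 : 0 < p.
Proof. exact: lt_le_trans p1. Qed.

Let moment_fine : (\int[P]_w (unit_max (tau w) `^ p) = D%:E)%E.
Proof.
rewrite /D fineK // ge0_fin_numE //.
by apply: integral_ge0 => w _; exact: poweR_ge0.
Qed.

Let D0 : 0 <= D.
Proof. by apply: fine_ge0; apply: integral_ge0 => w _; exact: poweR_ge0. Qed.

(** The steps [u i] have norm at most 1, so that the sum of their lengths is at
    most [#|I|] times [unit_max] and has a finite moment of order [p > p']. *)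
Lemma ae_lattice_averages (p' : R) : 1 <= p' -> p' < p ->
  {ae P, forall w, exists2 K, 0 <= K & forall n, (0 < n)%N ->
    box_sum u n (enum I) (fun z => (\sum_i (tau w z (z + u i))%:num) `^ p') 0
      <= n%:R ^+ #|I| * K}.
Proof.
move=> p'1 p'p; have p'0 : 0 < p' by rewrite (lt_le_trans ltr01).
pose h (q : paths R d) := \sum_i (q 0 (u i))%:num.
have h0 q : 0 <= h q by apply: sumr_ge0.
have mh : measurable_fun setT h.
  by apply: measurable_sum => i; exact: measurable_coord.
pose f q := h q `^ p'.
have mf : measurable_fun setT f by exact: (measurableT_comp (measurable_powR p') mh).
have q1 : 1 < p / p' by rewrite ltr_pdivlMr // mul1r.
pose c : R := #|I|%:R.
have fD : (\int[law P mtau]_q (f q `^ (p / p'))%:E <= (c `^ p * D)%:E)%E.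
  have E q : f q `^ (p / p') = h q `^ p.
    by rewrite /f -powRrM mulrCA divff ?mulr1 // gt_eqF.
  under eq_integral do rewrite E.
  have mhp : measurable_fun setT (fun q => (h q `^ p)%:E).
    by apply/measurable_EFinP; exact: (measurableT_comp (measurable_powR p) mh).
  have mU := measurableT_comp (measurable_poweR p) (measurable_unit_max tau_max).
  rewrite ge0_integral_law //; last by move=> q; rewrite lee_fin powR_ge0.
  apply: (@le_trans _ _ (\int[P]_w ((c `^ p)%:E * (unit_max (tau w) `^ p)))%E).
    apply: ge0_le_integral => //.
    - by move=> w _; rewrite lee_fin powR_ge0.
    - exact: (measurable_comp_tau mtau mhp).
    - apply: emeasurable_funM => //; exact: mU.
    - move=> w _; rewrite -!poweR_EFin -poweRM ?lee_fin ?unit_max_ge0 //.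
      have hU : ((h (tau w))%:E <= c%:E * unit_max (tau w))%E.
        rewrite /h -sumEFin.
        apply: (@le_trans _ _ (\sum_(i : I) unit_max (tau w))%E).
          by apply: lee_sum => i _; exact: le_unit_max.
        have -> : (\sum_(i : I) unit_max (tau w) = c%:E * unit_max (tau w))%E.
          rewrite -big_enum /c cardE /=.
          elim: (enum I) => [|i s IH]; first by rewrite big_nil mul0e.
          rewrite big_cons IH -nat1r EFinD ge0_muleDl ?lee_fin ?ler0n //.
          by rewrite mul1e.
        by [].
      apply: gt0_ler_poweR => //; first exact: ltW.
      + by rewrite in_itv /= leey andbT lee_fin.
      + by rewrite in_itv /= leey andbT mule_ge0 ?lee_fin ?unit_max_ge0.
  rewrite ge0_integralZl_EFin ?powR_ge0 //; last by move=> w _; exact: poweR_ge0.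
  by rewrite moment_fine EFinM.
have := ae_bounded_orbit_averages
  (fun i => measurable_translate (u i)) (fun i => law_translate mtau tau_stat (u i))
  (enum I) q1 mf (fun q => powR_ge0 _ _) fD.
move=> /ae_law; apply: filterS => w [K K0 HK]; exists K => // n n0.
have := HK n n0; rewrite -cardE -[tau w]translate0 orbit_sum_translate.
under box_sum_ext.
  move=> z; rewrite /f /h; under eq_bigr do rewrite !translateE add0r [u _ + z]addrC.
  over.
by rewrite translate0.
Qed.

Hypothesis dim_lt : #|I|%:R < p.

(** There are [2 ^ (M * #|I|)] points, and [unit_max] has the same law at each
    of them. By Markov's inequality some value exceeds [b ^+ M] with probability
    at most a constant times (2^#|I| / b^p)^M, which is summable when b lies
    between 2^(#|I| / p) and 2. *)
Lemma ae_unit_max_growth : exists2 b : R, 0 < b < 2 &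
  {ae P, forall w, \forall M \near \oo, forall k : I -> nat,
     (forall i, k i < 2 ^ M)%N ->
     (unit_max (translate (lattice_pt u (enum I) k) (tau w)) <= (b ^+ M)%:E)%E}.
Proof.
(* [b `^ p = 2 `^ e] with [e] the midpoint of [#|I|] and [p]. *)
pose c : R := #|I|%:R; pose e := (c + p) / 2.
have cp : c < p by [].
have [ce ep] : c < e /\ e < p by rewrite /e !midf_lt.
pose b : R := 2 `^ (e / p).
have b0 : 0 < b by exact: powR_gt0.
have lt_pow (x y : R) : x < y -> 2 `^ x < 2 `^ y :> R.
  by move=> xy; rewrite /powR pnatr_eq0 /= ltr_expR ltr_pM2r ?ln_gt0 ?ltr1n.
have b2 : b < 2.
  by rewrite -[ltRHS]powRr1 //; apply: lt_pow; rewrite ltr_pdivrMr // mul1r.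
exists b; first by rewrite b0.
pose U z w := unit_max (translate z (tau w)).
have mU z : measurable_fun setT (U z) by exact: (tau_max (- z)).1.
pose z M (k : {ffun I -> 'I_(2 ^ M)}) := lattice_pt u (enum I) (fun i => k i).
pose A M (k : {ffun I -> 'I_(2 ^ M)}) := [set w | ((b ^+ M)%:E < U (z M k) w)%E].
have mA M k : measurable (A M k) by exact: measurable_egt.
have bp M : (b ^+ M) `^ p = (2 `^ e) ^+ M.
  rewrite -powR_mulrn ?ltW // powRAC.
  have -> : b `^ p = 2 `^ e by rewrite /b -powRrM divfK // gt_eqF.
  by rewrite powR_mulrn ?powR_ge0.
have PA M k : (P (A M k) <= (D / (2 `^ e) ^+ M)%:E)%E.
  have -> : P (A M k) = P [set w | ((b ^+ M)%:E < unit_max (tau w))%E].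
    have := (tau_max (- z M k)).2 `](b ^+ M)%:E, +oo%E]%classic (emeasurable_itv _).
    rewrite /A /U /translate /= => H.
    have E (g : T -> \bar R) : [set w | (`](b ^+ M)%:E, +oo%E]%classic (g w))] =
        [set w | ((b ^+ M)%:E < g w)%E].
      by apply/seteqP; split => w /=; rewrite in_itv /= leey andbT.
    by rewrite !E in H.
  have mUp := measurableT_comp (measurable_poweR p) (measurable_unit_max tau_max).
  have c0 : 0 < (2 `^ e) ^+ M :> R by rewrite exprn_gt0 // powR_gt0.
  have mD : (\int[P]_w (unit_max (tau w) `^ p) <= D%:E)%E by rewrite moment_fine.
  apply: le_trans (markov_egt c0 mUp (fun w => poweR_ge0 _ _) mD).
  apply: le_measure; rewrite ?inE.
  - exact: measurable_egt (measurable_unit_max tau_max).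
  - exact: measurable_egt mUp.
  move=> w /=; rewrite -bp; case: (unit_max (tau w)) => [r| |] //=.
    rewrite !lte_fin => br.
    apply: gt0_ltr_powR => //; rewrite nnegrE ?exprn_ge0 ?ltW //.
    by rewrite (le_lt_trans _ br) // exprn_ge0 // ltW.
  by move=> _; rewrite (gt_eqF p0) ltry.
pose F M := [set w | exists2 k, k \in enum {ffun I -> 'I_(2 ^ M)} & A M k w].
have FM M := measure_exists_le (enum {ffun I -> 'I_(2 ^ M)}) (mA M) (PA M).
pose r : R := 2 `^ (c - e).
have r0 : 0 < r by exact: powR_gt0.
have r1 : r < 1.
  by rewrite -[ltRHS](powRr0 2); apply: lt_pow; rewrite subr_lt0.
have sizeM M : (size (enum {ffun I -> 'I_(2 ^ M)}))%:R * (D / (2 `^ e) ^+ M) = D * r ^+ M.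
  rewrite -cardE card_ffun card_ord mulrCA; congr (_ * _).
  rewrite -expnM mulnC natrX exprM -[2 ^+ #|I|]powR_mulrn //.
  by rewrite -expr_div_n /r powRB ?pnatr_eq0 ?implybT.
have sumF : (\sum_(M <oo) P (F M) < +oo)%E.
  apply: (@le_lt_trans _ _ (D / (1 - r))%:E); last by rewrite ltry.
  apply: lime_le; first by apply: is_cvg_nneseries => n _ _; exact: measure_ge0.
  apply: nearW => n; apply: (@le_trans _ _ (\sum_(0 <= k < n) D * r ^+ k)%:E).
    rewrite -sumEFin; apply: lee_sum => k _.
    by rewrite -sizeM; exact: (FM k).2.
  rewrite lee_fin; apply: le_trans (geometric_le_lim n D0 r0 _).
    by rewrite /series /geometric.
  by rewrite ger0_norm // ltW.
have F0 := lim_sup_set_cvg0 (fun M => (FM M).1) sumF.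
exists (lim_sup_set F); split => //.
  apply: bigcap_measurable => // n _; apply: bigcup_measurable => k _.
  exact: (FM k).1.
move=> w /= Hw n _; apply: contrapT => Hn; apply: Hw.
exists n => // M /= nM k kM; rewrite leNgt; apply/negP => lt_k; apply: Hn.
exists M => //; exists [ffun i => Ordinal (kM i)]; first by rewrite mem_enum.
rewrite /A /U /z /=.
have -> : lattice_pt u (enum I) (fun i => [ffun i => Ordinal (kM i)] i) =
   lattice_pt u (enum I) k by apply: eq_bigr => i _; rewrite ffunE.
by [].
Qed.

End LatticeFields.

(** * From lattice directions to an octant *)

Section Assembly.
Context {R : realType} {V : normedModType R} {I : finType}.
Variable u : I -> V.
Hypothesis u_sup : forall c : I -> R, (forall i, `|c i| <= 1) ->
  `|\sum_i c i *: u i| <= 1.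
Variable dist : V -> V -> R.
Hypothesis dist_refl : forall x, dist x x = 0.
Hypothesis dist_sym : forall x y, dist x y = dist y x.
Hypothesis dist_tri : forall x y z, dist x y <= dist x z + dist z y.

Notation pt := (lattice_pt u (enum I)).

Lemma dist_ge0 x y : 0 <= dist x y.
Proof. by have := dist_tri x x y; rewrite dist_refl (dist_sym y x); lra. Qed.

Lemma exists_small_power (x c e : R) : 0 <= x < 1 -> 0 < e ->
  exists N, forall n, (N <= n)%N -> c * x ^+ n <= e.
Proof.
move=> /andP[x0 x1] e0.
have cv : (fun n => c * x ^+ n) @ \oo --> (0 : R).
  by apply: cvg_geometric; rewrite ger0_norm.
move/cvgrPdist_le : cv => /(_ e e0) [N _ HN]; exists N => n Nn.
have := HN n Nn; rewrite /= sub0r normrN; apply: le_trans; exact: ler_norm.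
Qed.

Lemma lattice_ptE k : pt k = \sum_i (k i)%:R *: u i.
Proof.
by rewrite /lattice_pt big_enum /=; apply: eq_bigr => i _; rewrite scaler_nat.
Qed.

Lemma u_sup_le (c : I -> R) (l : R) : 0 < l -> (forall i, `|c i| <= l) ->
  `|\sum_i c i *: u i| <= l.
Proof.
move=> l0 cl; have -> : \sum_i c i *: u i = l *: \sum_i (c i / l) *: u i.
  rewrite scaler_sumr; apply: eq_bigr => i _.
  by rewrite scalerA mulrC divfK // gt_eqF.
rewrite normrZ gtr0_norm // -[leRHS]mulr1 ler_wpM2l ?(ltW l0) //; apply: u_sup => i.
by rewrite normrM normfV (gtr0_norm l0) ler_pdivrMr // mul1r.
Qed.

Section Morrey.
Variables (p K : R).
Hypothesis p1 : 1 <= p.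
Hypothesis p_dim : #|I|%:R < p.
Hypothesis K0 : 0 <= K.
Hypothesis avg : forall n, (0 < n)%N ->
  box_sum u n (enum I) (fun z => (\sum_i dist z (z + u i)) `^ p) 0 <= n%:R ^+ #|I| * K.

(** The average of [h] over a cube of side [2 ^ k] in the box of side [2 ^ M] is
    at most [(1 + K) * b ^+ (M - k)], where [b `^ p = 2 ^+ #|I|]. As [b < 2],
    the doubling costs [2 ^ k * b ^+ (M - k)] grow geometrically with [k] and the
    last one dominates. *)
Lemma morrey_dist_le : exists C r, [/\ 0 <= r < 1 & forall M m c w, (m <= M)%N ->
  (forall i, c i + 2 ^ m <= 2 ^ M)%N -> (forall i, w i < 2 ^ m)%N ->
  dist (pt c) (pt (fun i => (c i + w i)%N)) <= C * r ^+ (M - m) * (2 ^ M)%:R].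
Proof.
have p0 : 0 < p by exact: lt_le_trans p1.
pose b : R := 2 `^ (#|I|%:R / p).
have b0 : 0 < b by exact: powR_gt0.
have b2 : b < 2.
  rewrite -[ltRHS]powRr1 // /b /powR pnatr_eq0 /= ltr_expR ltr_pM2r ?ln_gt0 ?ltr1n //.
  by rewrite ltr_pdivrMr // mul1r.
have bp : b `^ p = 2 ^+ #|I| by rewrite /b -powRrM divfK ?gt_eqF // powR_mulrn.
pose h z := \sum_i dist z (z + u i).
have h0 z : 0 <= h z by apply: sumr_ge0 => i _; exact: dist_ge0.
have h_step i z : dist z (z + u i) <= h z.
  by rewrite /h (bigD1 i) //= lerDl; apply: sumr_ge0 => j _; exact: dist_ge0.
pose C1 := 2 ^+ #|I| * (1 + K) / (2 - b).
have C1E : C1 * (2 - b) = 2 ^+ #|I| * (1 + K) by rewrite /C1 divfK // gt_eqF // subr_gt0.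
have C10 : 0 <= C1.
  have bb : 0 <= 2 - b by rewrite subr_ge0 ltW.
  by rewrite /C1 divr_ge0 // mulr_ge0 ?exprn_ge0 ?addr_ge0.
exists (2 * C1), (b / 2); split.
  by rewrite divr_ge0 ?(ltW b0) //= ltr_pdivrMr // mul1r.
move=> M m c w mM cM wm.
pose H k := b ^+ (M - k) * (1 + K).
pose A k := C1 * ((2 ^ k)%:R * b ^+ (M - k)).
have box_h k c' : (k <= M)%N -> (forall i, c' i + 2 ^ k <= 2 ^ M)%N ->
    box_sum u (2 ^ k) (enum I) h (pt c') <= (2 ^ k)%:R ^+ size (enum I) * H k.
  move=> kM c'M; rewrite -cardE.
  (* The threshold that balances the two terms of [le_add_powR]. *)
  pose t := b ^+ (M - k); have t0 : 0 < t by rewrite exprn_gt0.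
  have tp : t `^ p = (2 ^ (M - k))%:R ^+ #|I|.
    rewrite /t -powR_mulrn ?ltW // powRAC bp natrX -[_ ^+ (M - k) ^+ _]exprM mulnC exprM.
    by rewrite powR_mulrn // exprn_ge0.
  have tp0 : 0 < t `^ p by exact: powR_gt0.
  apply: (@le_trans _ _ (box_sum u (2 ^ k) (enum I) (fun z => t + t / t `^ p * h z `^ p) (pt c'))).
    by apply: box_sum_le => z; rewrite [_ * h z `^ p]mulrC; exact: le_add_powR.
  rewrite box_sumD box_sum_cst box_sumZ -cardE /H -/t mulrDr mulr1 mulrDr lerD2l.
  have b1 : box_sum u (2 ^ k) (enum I) (fun z => h z `^ p) (pt c') <=
      (2 ^ M)%:R ^+ #|I| * K.
    have M0 : (0 < 2 ^ M)%N by rewrite expn_gt0.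
    apply: le_trans (avg M0); rewrite -[pt c']add0r.
    by apply: box_sum_sub => // z; exact: powR_ge0.
  have EM : (2 ^ M)%:R ^+ #|I| = (2 ^ k)%:R ^+ #|I| * t `^ p.
    by rewrite tp -exprMn -natrM -expnD subnKC.
  apply: (@le_trans _ _ (t / t `^ p * ((2 ^ M)%:R ^+ #|I| * K))).
    by rewrite ler_wpM2l // divr_ge0 ?ltW.
  rewrite EM le_eqVlt; apply/orP; left; apply/eqP.
  by field; rewrite gt_eqF.
have A0 : 0 <= A 0 by rewrite /A mulr_ge0 // mulr_ge0 // exprn_ge0 // ltW.
have AS k : (k < M)%N -> A k + 2 ^+ size (enum I) * ((2 ^ k)%:R * H k.+1) <= A k.+1.
  move=> kM; rewrite -cardE /A /H.
  have -> : (M - k = (M - k.+1).+1)%N by rewrite subnSK.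
  rewrite expnS natrM exprS le_eqVlt; apply/orP; left; apply/eqP.
  move: (b ^+ (M - k.+1)) ((2 ^ k)%:R : R) => x y.
  have -> : 2 ^+ #|I| * (y * (x * (1 + K))) = (C1 * (2 - b)) * (y * x).
    by rewrite C1E; ring.
  by ring.
have := cube_dist_le dist_refl dist_sym dist_tri h0 h_step box_h A0 AS mM cM wm.
move=> h1; apply: (le_trans h1); rewrite /A le_eqVlt; apply/orP; left; apply/eqP.
have -> : (2 ^ M)%:R = (2 ^ m)%:R * 2 ^+ (M - m) :> R.
  by rewrite -natrX -natrM -expnD subnKC.
by rewrite expr_div_n; field; rewrite expf_neq0.
Qed.

End Morrey.

Variables (mu : V -> R) (C : R).
Hypothesis C0 : 0 <= C.
Hypothesis muD : forall x y, mu (x + y) <= mu x + mu y.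
Hypothesis muN : forall x, mu (- x) = mu x.
Hypothesis mu_mulrn : forall x n, mu (x *+ n) = mu x * n%:R.
Hypothesis mu_le : forall x, mu x <= C * `|x|.

(** With [m = M - L] for a large fixed [L], a point [x] of the octant is joined
    to the lattice point [pt k] of its integral parts, and this one to the
    corner [pt c] of its dyadic cube of side [2 ^ m]. The four errors are: the
    distance of [x] to [pt k], at most [b ^+ M]; the distance of [pt k] to
    [pt c], bounded by Morrey's inequality; the deviation of [dist 0 (pt c)]
    from [mu (pt c)], where [pt c] is [2 ^ m] times one of finitely many
    directions; and the difference of [mu] at [pt c] and [x]. *)
Lemma octant_shape (p b : R) (e : R) :
  1 <= p -> #|I|%:R < p ->
  (exists2 K, 0 <= K & forall n, (0 < n)%N ->
    box_sum u n (enum I) (fun z => (\sum_i dist z (z + u i)) `^ p) 0 <= n%:R ^+ #|I| * K) ->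
  0 < b < 2 ->
  (\forall M \near \oo, forall k, (forall i, k i < 2 ^ M)%N ->
     forall y, `|y| <= 1 -> dist (pt k) (pt k + y) <= b ^+ M) ->
  (forall v e', 0 < e' -> \forall m \near \oo,
     `|dist 0 (pt v *+ 2 ^ m) - mu (pt v) * (2 ^ m)%:R| <= e' * (2 ^ m)%:R) ->
  0 < e ->
  \forall M \near \oo, forall t : I -> R, (forall i, 0 <= t i < (2 ^ M)%:R) ->
    `|dist 0 (\sum_i t i *: u i) - mu (\sum_i t i *: u i)| <= e * (2 ^ M)%:R.
Proof.
move=> p1 pI [K K0 avg] /andP[b0 b2] growth dyadic e0.
have e40 : 0 < e / 4 by rewrite divr_gt0.
have [C1 [r [r01 morrey]]] := morrey_dist_le p1 pI K0 avg.
have [L1 HL1] := exists_small_power C1 r01 e40.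
have h01 : 0 <= (2^-1 : R) < 1 by rewrite invr_ge0 ler0n invf_lt1 ?ltr1n.
have [L2 HL2] := exists_small_power C h01 e40.
pose L := maxn L1 L2.
have b01 : 0 <= b / 2 < 1 by rewrite divr_ge0 ?ltW //= ltr_pdivrMr // mul1r.
have [N1 HN1] := exists_small_power 1 b01 e40.
have [N2 _ HN2] : \forall m \near \oo, forall v : {ffun I -> 'I_(2 ^ L)},
    `|dist 0 (pt (fun i => v i) *+ 2 ^ m) - mu (pt (fun i => v i)) * (2 ^ m)%:R|
      <= e / 4 * (2 ^ m)%:R.
  by apply: filter_forall => v; exact: dyadic.
have [N3 _ HN3] := growth.
exists (maxn N1 (maxn (N2 + L) N3)) => // M /=.
rewrite !geq_max => /and3P[MN1 MN2 MN3] t tM.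
have LM : (L <= M)%N by rewrite (leq_trans _ MN2) // leq_addl.
pose m := (M - L)%N.
have mM : (m <= M)%N by exact: leq_subr.
have EM : (2 ^ M = 2 ^ m * 2 ^ L)%N by rewrite -expnD subnK.
pose k i := Num.truncn (t i).
have kt i : (k i)%:R <= t i < (k i).+1%:R.
  by apply: truncn_itv; have /andP[] := tM i.
have kM i : (k i < 2 ^ M)%N.
  have /andP[h1 _] := kt i; have /andP[_ h2] := tM i.
  by rewrite -(ltr_nat R) (le_lt_trans h1).
pose v i := (k i %/ 2 ^ m)%N.
have m0 : (0 < 2 ^ m)%N by rewrite expn_gt0.
have vL i : (v i < 2 ^ L)%N by rewrite /v ltn_divLR // mulnC -EM.
pose c i := (2 ^ m * v i)%N.
pose w i := (k i %% 2 ^ m)%N.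
have kE i : (c i + w i = k i)%N by rewrite /c /w mulnC -divn_eq.
have cM i : (c i + 2 ^ m <= 2 ^ M)%N.
  by rewrite /c EM -mulnSr leq_mul2l vL orbT.
have wm i : (w i < 2 ^ m)%N by rewrite ltn_mod.
set x := \sum_i _.
have ptk : pt (fun i => (c i + w i)%N) = pt k.
  by apply: eq_bigr => i _; rewrite kE.
have ptc : pt c = pt v *+ 2 ^ m by rewrite /c lattice_ptM.
have q0 : 0 < (2 ^ M)%:R :> R by rewrite ltr0n expn_gt0.
have qm : (2 ^ m)%:R <= (2 ^ M)%:R :> R by rewrite ler_nat leq_exp2l.
have err1 : dist (pt k) x <= e / 4 * (2 ^ M)%:R.
  have xk : `|x - pt k| <= 1.
    rewrite lattice_ptE /x -sumrB; under eq_bigr do rewrite -scalerBl.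
    apply: u_sup => i; have /andP[h1 h2] := kt i.
    by rewrite -natr1 in h2; rewrite ler_norml; apply/andP; split; lra.
  have := HN3 M MN3 k kM _ xk; rewrite addrC subrK => h; apply: (le_trans h).
  have := HN1 M MN1; rewrite mul1r expr_div_n -natrX ler_pdivrMr //.
have err2 : dist (pt c) (pt k) <= e / 4 * (2 ^ M)%:R.
  rewrite -ptk; apply: (le_trans (morrey M m c w mM cM wm)).
  rewrite ler_wpM2r ?(ltW q0) //; apply: HL1.
  by rewrite /m subKn // leq_max leqnn.
have err3 : `|dist 0 (pt c) - mu (pt c)| <= e / 4 * (2 ^ M)%:R.
  have N2m : (N2 <= m)%N by rewrite /m leq_subRL // addnC.
  have := HN2 m N2m [ffun i => Ordinal (vL i)].
  have -> : pt (fun i => [ffun i => Ordinal (vL i)] i) = pt v.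
    by apply: eq_bigr => i _; rewrite ffunE.
  rewrite ptc mu_mulrn => h; apply: (le_trans h).
  by rewrite ler_wpM2l // ltW.
have err4 : `|mu x - mu (pt c)| <= e / 4 * (2 ^ M)%:R.
  have le1 : `|mu x - mu (pt c)| <= mu (x - pt c).
    have h1 := muD (x - pt c) (pt c); have h2 := muD (pt c - x) x.
    rewrite subrK in h1; rewrite subrK -[pt c - x]opprB muN in h2.
    by rewrite ler_norml; apply/andP; split; lra.
  apply: (le_trans le1); apply: (le_trans (mu_le _)).
  have : `|x - pt c| <= (2 ^ m)%:R.
    rewrite lattice_ptE /x -sumrB; under eq_bigr do rewrite -scalerBl.
    apply: u_sup_le; first by rewrite ltr0n.
    move=> i; have /andP[h1 h2] := kt i.
    have c_le : (c i)%:R <= (k i)%:R :> R by rewrite ler_nat -kE leq_addr.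
    have k_lt : (k i).+1%:R <= (c i)%:R + (2 ^ m)%:R :> R.
      by rewrite -natrD ler_nat -kE ltn_add2l.
    by rewrite ler_norml; apply/andP; split; lra.
  move=> h; apply: (@le_trans _ _ (C * (2 ^ m)%:R)); first by rewrite ler_wpM2l.
  have L2L : (L2 <= L)%N by rewrite leq_max leqnn orbT.
  have := HL2 L L2L; rewrite exprVn -natrX => h2.
  have EMr : (2 ^ m)%:R = (2 ^ L)%:R^-1 * (2 ^ M)%:R :> R.
    by rewrite EM natrM mulrCA mulVf ?mulr1 // pnatr_eq0 -lt0n expn_gt0.
  by rewrite EMr mulrA ler_wpM2r // ltW.
have d1 := dist_tri 0 x (pt k); have d2 := dist_tri 0 (pt k) x.
have d3 := dist_tri 0 (pt k) (pt c); have d4 := dist_tri 0 (pt c) (pt k).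
rewrite (dist_sym x) in d2; rewrite (dist_sym (pt k) (pt c)) in d4.
move: err3 err4; rewrite !ler_norml => /andP[? ?] /andP[? ?].
by apply/andP; split; lra.
Qed.

End Assembly.

(** * Octants of the space and the shape theorem *)

Section Norms.
Context {R : realType} {d : nat}.
Implicit Types x : 'rV[R]_d.

Lemma row_norm_le x (l : R) : 0 <= l -> (forall i, `|x 0 i| <= l) -> `|x| <= l.
Proof.
move=> l0 xl; rewrite /Num.norm /= mx_normrE; apply/bigmax_leP; split => // -[i j] _ /=.
by rewrite ord1.
Qed.

Lemma le_row_norm x i : `|x 0 i| <= `|x|.
Proof.
rewrite [leRHS]/Num.norm /= mx_normrE.
exact: (le_bigmax _ (fun ij : 'I_1 * 'I_d => `|x ij.1 ij.2|) (ord0, i)).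
Qed.

Lemma norm_le_norm2 x : `|x| <= norm2 x.
Proof.
apply: row_norm_le => [|i]; first exact: sqrtr_ge0.
rewrite -sqrtr_sqr; apply: ler_wsqrtr; rewrite (bigD1 i) //= lerDl.
by apply: sumr_ge0 => j _; exact: sqr_ge0.
Qed.

Lemma norm2_le x : norm2 x <= d%:R * `|x|.
Proof.
rewrite -(ger0_norm (_ : 0 <= d%:R * `|x|)) ?mulr_ge0 // -sqrtr_sqr.
apply: ler_wsqrtr; apply: (@le_trans _ _ (\sum_(i < d) `|x| ^+ 2)).
  apply: ler_sum => i _; rewrite -[x 0 i ^+ 2]real_normK ?num_real //.
  by rewrite lerXn2r ?nnegrE // le_row_norm.
rewrite sumr_const card_ord -[_ *+ d]mulr_natl exprMn ler_wpM2r ?sqr_ge0 //.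
by rewrite -natrX ler_nat; case: (d) => // n; rewrite expnS expn1 leq_pmulr.
Qed.

(** With these vectors as lattice steps, the lattice points of an octant have
    natural numbers as coordinates. *)
Definition signed_unit (s : {ffun 'I_d -> bool}) (i : 'I_d) : 'rV[R]_d :=
  (-1) ^+ s i *: delta_mx 0 i.

Lemma sum_signed_unitE s (c : 'I_d -> R) j :
  (\sum_i c i *: signed_unit s i) 0 j = (-1) ^+ s j * c j.
Proof.
rewrite summxE (bigD1 j) //= big1 ?addr0 => [|i ij].
  by rewrite !mxE !eqxx mulr1 mulrC.
by rewrite !mxE eqxx /= eq_sym (negbTE ij) !mulr0.
Qed.

Lemma signed_unit_sup s (c : 'I_d -> R) : (forall i, `|c i| <= 1) ->
  `|\sum_i c i *: signed_unit s i| <= 1.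
Proof.
move=> c1; apply: row_norm_le => // i.
by rewrite sum_signed_unitE normrM normr_sign mul1r.
Qed.

Lemma signed_unit_norm s i : `|signed_unit s i| <= 1.
Proof.
have := @signed_unit_sup s (fun j => (j == i)%:R)
  (fun j => ltac:(by rewrite normr_nat lern1 leq_b1)).
by rewrite (bigD1 i) //= eqxx scale1r big1 ?addr0 // => j /negbTE ->; rewrite scale0r.
Qed.

Lemma octant_decomposition x :
  x = \sum_i `|x 0 i| *: signed_unit [ffun i => x 0 i < 0] i.
Proof.
apply/rowP => j; rewrite sum_signed_unitE ffunE [LHS]numEsign.
by rewrite mulr_sign.
Qed.

End Norms.

Section ShapeTheorem.
Context {R : realType} {disp : measure_display} {T : measurableType disp} {d : nat}.
Variables (P : probability T R) (tau : T -> path_space R d).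
Hypothesis tau_pseudo : random_pseudometric P tau.
Hypothesis tau_erg : ergodic P tau.
Hypothesis tau_max : stationary_unit_max P tau.
Variable eps : R.
Hypothesis eps0 : 0 < eps.
Hypothesis d0 : (0 < d)%N.
Let p := d%:R + eps.
Hypothesis moment : (\int[P]_w (unit_max (tau w) `^ p) < +oo)%E.

Let d1 : 1 <= d%:R :> R. Proof. by rewrite ler1n. Qed.
Let p1 : 1 <= p. Proof. by have := d1; have := eps0; rewrite /p; lra. Qed.
Let tau_stat := tau_erg.1.
Notation mu := (asymp (mean P tau)).

Let m_ge0 := mean_ge0 tau_pseudo tau_stat tau_max p1 moment.
Let mD := meanD tau_pseudo tau_stat tau_max p1 moment.
Let mN := meanN tau_pseudo tau_stat.
Let mle := mean_le tau_pseudo tau_stat tau_max p1 moment.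

Lemma seminorm_asymp : seminorm mu.
Proof.
split; [exact: asymp_ge0 | exact: (asympZ m_ge0 mN mD mle) | exact: asympD].
Qed.

Lemma ae_octant_shape s : {ae P, forall w, forall e, 0 < e ->
  \forall M \near \oo, forall t : 'I_d -> R, (forall i, 0 <= t i < (2 ^ M)%:R) ->
    `|(tau w 0 (\sum_i t i *: signed_unit s i))%:num - mu (\sum_i t i *: signed_unit s i)|
       <= e * (2 ^ M)%:R}.
Proof.
pose u : 'I_d -> 'rV[R]_d := signed_unit s.
have u1 i : `|u i| <= 1 by exact: signed_unit_norm.
pose p' := d%:R + eps / 2.
have p'1 : 1 <= p' by have := d1; have := eps0; rewrite /p'; lra.
have p'p : p' < p by have := eps0; rewrite /p' /p; lra.
have dp : #|'I_d|%:R < p by rewrite card_ord /p ltrDl.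
have dp' : #|'I_d|%:R < p' by rewrite card_ord /p' ltrDl divr_gt0.
have [b b02 growth] := ae_unit_max_growth tau_max p1 moment u dp.
have avg := ae_lattice_averages tau_pseudo tau_stat tau_max p1 moment u1 p'1 p'p.
have dyadic : {ae P, forall w (k : {ffun 'I_d -> nat} * nat), \forall m \near \oo,
    `|(tau w 0 (lattice_pt u (enum 'I_d) k.1 *+ 2 ^ m))%:num -
       mu (lattice_pt u (enum 'I_d) k.1) * (2 ^ m)%:R| <= k.2.+1%:R^-1 * (2 ^ m)%:R}.
  apply: ae_forall => k.
  by apply: (ae_dyadic_limit tau_pseudo tau_erg tau_max p1 moment); rewrite invr_gt0.
apply: filter_app dyadic; apply: filter_app avg; apply: filter_app growth.
apply: filterS tau_pseudo.2 => w [h0 sym tri] growth avg dyadic e e0.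
have C0 : 0 <= unit_mean P tau.
  by have := mle 0; have := m_ge0 0; rewrite normr0; lra.
have mu_mulrn x n : mu (x *+ n) = mu x * n%:R.
  by rewrite -scaler_nat (asympZ m_ge0 mN mD mle) normr_nat mulrC.
have u_growth : \forall M \near \oo, forall k, (forall i, k i < 2 ^ M)%N ->
    forall y, `|y| <= 1 ->
      (tau w (lattice_pt u (enum 'I_d) k) (lattice_pt u (enum 'I_d) k + y))%:num <= b ^+ M.
  move: growth; apply: filterS => M HM k kM y y1.
  rewrite -lee_fin; apply: le_trans (HM k kM).
  have := le_unit_max (translate (lattice_pt u (enum 'I_d) k) (tau w)) y1.
  by rewrite translateE add0r addrC.
have u_dyadic v e' : 0 < e' -> \forall m \near \oo,
    `|(tau w 0 (lattice_pt u (enum 'I_d) v *+ 2 ^ m))%:num -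
       mu (lattice_pt u (enum 'I_d) v) * (2 ^ m)%:R| <= e' * (2 ^ m)%:R.
  move=> e'0; pose n := Num.truncn e'^-1.
  have := dyadic ([ffun i => v i], n); apply: filterS => m /=.
  have -> : lattice_pt u (enum 'I_d) [ffun i => v i] = lattice_pt u (enum 'I_d) v.
    by apply: eq_bigr => i _; rewrite ffunE.
  move=> h; apply: (le_trans h); rewrite ler_wpM2r //.
  by rewrite invf_ple ?posrE // ltW //; exact: truncnS_gt.
exact: (@octant_shape R _ _ u (@signed_unit_sup R d s) (fun x y => (tau w x y)%:num)
  h0 sym tri mu (unit_mean P tau) C0 (asympD m_ge0 mD) (asympN mN) mu_mulrn
  (asymp_le_norm m_ge0 mle) p' b e p'1 dp' avg b02 u_growth u_dyadic e0).
Qed.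

(** A large [x] is handled at the scale [2 ^ M] with
    [2 ^ M.-1 <= `|x| < 2 ^ M], in the octant given by its signs. *)
Lemma ae_shape : {ae P, forall w,
  (norm2 x)^-1 * ((tau w 0 x)%:num - mu x)
     @[x --> norm2_pinfty (R := R) (d := d)] --> (0 : R)}.
Proof.
have FF : Filter (norm2_pinfty (R := R) (d := d)).
  apply: filter_from_filter; first by exists 0.
  move=> M N _ _; exists (Num.max M N) => // x /=.
  by rewrite gt_max => /andP[].
have := ae_forall ae_octant_shape; apply: filterS => w H.
apply/cvgrPdist_le => e e0.
have e20 : 0 < e / 2 by rewrite divr_gt0.
have [M0 _ HM0] : \forall M \near \oo, forall s (t : 'I_d -> R),
    (forall i, 0 <= t i < (2 ^ M)%:R) ->
    `|(tau w 0 (\sum_i t i *: signed_unit s i))%:num - mu (\sum_i t i *: signed_unit s i)|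
       <= e / 2 * (2 ^ M)%:R.
  by apply: filter_forall => s; exact: H.
exists (d%:R * (2 ^ M0)%:R) => // x /= x_big.
have dr : 0 < d%:R :> R by rewrite ltr0n.
have nx : (2 ^ M0)%:R < `|x|.
  by rewrite -(ltr_pM2l dr) (lt_le_trans x_big) // norm2_le.
have x1 : 1 < `|x| by apply: le_lt_trans nx; rewrite ler1n expn_gt0.
pose n := Num.truncn `|x|.
have /andP[n_le n_gt] := truncn_itv (normr_ge0 x).
have n0 : (0 < n)%N by rewrite /n -(@ltr_nat R); move: n_gt; rewrite -natr1; lra.
pose M := (trunc_log 2 n).+1.
have /andP[logn_le logn_gt] := trunc_log_bounds (leqnn 2) n0.
have xM : `|x| < (2 ^ M)%:R by apply: (lt_le_trans n_gt); rewrite ler_nat.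
have Mx : (2 ^ M)%:R <= 2 * `|x|.
  rewrite /M expnS natrM ler_wpM2l //; apply: le_trans n_le.
  by rewrite ler_nat.
have M0M : (M0 <= M)%N.
  by rewrite ltnW // -(ltn_exp2l _ _ (leqnn 2)) -(@ltr_nat R) (lt_trans nx).
have := HM0 M M0M [ffun i => x 0 i < 0] (fun i => `|x 0 i|) (fun i => ltac:(
  by rewrite normr_ge0 /= (le_lt_trans (le_row_norm x i)))).
rewrite -octant_decomposition => h.
have n2 : 0 < norm2 x by rewrite (lt_le_trans _ (norm_le_norm2 x)) // (lt_trans ltr01).
rewrite sub0r normrN normrM normfV (gtr0_norm n2) mulrC ler_pdivrMr //.
apply: (le_trans h).
apply: (@le_trans _ _ (e * `|x|)).
  apply: le_trans (ler_wpM2l (ltW e20) Mx) _.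
  by rewrite mulrA divfK // pnatr_eq0.
by rewrite ler_wpM2l ?norm_le_norm2 // ltW.
Qed.

End ShapeTheorem.

Theorem theorem2p1 (R : realType) (disp : measure_display)
    (T : measurableType disp) (P : probability T R) (d : nat)
    (tau : T -> path_space R d)
    (tau_pseudo : random_pseudometric P tau)
    (tau_ergodic : ergodic P tau)
    (tau_max : stationary_unit_max P tau)
    (moment : exists2 eps : R, 0 < eps &
       (\int[P]_w (unit_max (tau w) `^ (d%:R + eps)) < +oo)%E) :
  exists2 mu : 'rV[R]_d -> R, seminorm mu &
    {ae P, forall w,
       (norm2 x)^-1 * ((tau w 0 x)%:num - mu x)
         @[x --> norm2_pinfty (R := R) (d := d)] --> (0 : R)}.
Proof.
have [eps eps0 moment_eps] := moment.
have [d0|d_gt0] := posnP d.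
  (* In dimension 0 no point has norm larger than 0. *)
  subst d; exists (fun=> 0).
    by split => [//|a x|x y]; rewrite ?mulr0 ?addr0.
  apply: aeW => w A _; exists 0 => // x /=.
  by rewrite /norm2 big_ord0 sqrtr0 ltxx.
exists (asymp (mean P tau)).
  exact: (seminorm_asymp tau_pseudo tau_ergodic tau_max eps0 d_gt0 moment_eps).
exact: (ae_shape tau_pseudo tau_ergodic tau_max eps0 d_gt0 moment_eps).
Qed.
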